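(* Every tree $\mathcal{P}$ (in the sense of tree polyominoes) is of König type with $\mathrm{height}\, I_{\mathcal{P}} = |\mathcal{P}|$.
   Context: Equip $\mathbb{N}^2$ with the componentwise partial order. For $\mathbf{a} \leq \mathbf{b}$ in $\mathbb{N}^2$, $[\mathbf{a},\mathbf{b}] = \{\mathbf{c} \in \mathbb{N}^2 : \mathbf{a} \leq \mathbf{c} \leq \mathbf{b}\}$. If $\mathbf{a} = (i,j)$, $\mathbf{b} = (i',j')$ with $i<i'$ and $j<j'$, the interval is proper, $\mathbf{a},\mathbf{b}$ are its diagonal corners and $\mathbf{c} = (i',j)$, $\mathbf{d} = (i,j')$ its anti-diagonal corners. A cell is an interval $C = [\mathbf{a}, \mathbf{a} + (1,1)]$; its vertices are its four corners (the set $V(C)$) and its edges are its four sides. A cell $[\mathbf{a}',\mathbf{b}']$ is a cell of $[\mathbf{a},\mathbf{b}]$ if $\mathbf{a} \leq \mathbf{a}'$ and $\mathbf{b}' \leq \mathbf{b}$. A polyomino $\mathcal{P}$ is a finite collection of cells of $\mathbb{N}^2$ such that any two cells $C, D$ of $\mathcal{P}$ are joined by a sequence $C = C_1, \ldots, C_m = D$ of cells of $\mathcal{P}$ with $C_i \cap C_{i+1}$ an edge of $C_i$ for $1 \leq i \leq m-1$. $|\mathcal{P}|$ is the number of cells and $V(\mathcal{P}) = \bigcup_{C \in \mathcal{P}} V(C)$. A polyomino is simple if it has no holes: regarding $\mathcal{P}$ as a collection of cells of $\mathbb{Z}^2$, any two cells of $\mathbb{Z}^2$ not belonging to $\mathcal{P}$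 can be joined by a sequence of cells not belonging to $\mathcal{P}$ in which consecutive cells share an edge. An inner interval of $\mathcal{P}$ is a proper interval all of whose cells belong to $\mathcal{P}$. A vertex of $\mathcal{P}$ is free if it belongs to exactly one cell of $\mathcal{P}$. A cell $C$ of $\mathcal{P}$ is a leaf of $\mathcal{P}$ if two of the vertices of $C$ are free. A simple polyomino $\mathcal{P}$ is a tree if $\mathcal{P}$ possesses a leaf and no inner interval of $\mathcal{P}$ is of the form $[\mathbf{a}, \mathbf{a} + (2,2)]$. Let $K$ be a field and $S = K[x_{\mathbf{a}} : \mathbf{a} \in V(\mathcal{P})]$. For an inner interval $[\mathbf{a},\mathbf{b}]$ with anti-diagonal corners $\mathbf{c},\mathbf{d}$, the inner 2-minor is $f_{\mathbf{a},\mathbf{b}} = x_{\mathbf{a}}x_{\mathbf{b}} - x_{\mathbf{c}}x_{\mathbf{d}}$. The polyomino ideal $I_{\mathcal{P}} \subset S$ is generated by all inner 2-minors of $\mathcal{P}$. $\mathcal{P}$ is of König type if, with $h = \mathrm{height}\, I_{\mathcal{P}}$, there exist a sequence of $h$ inner 2-minors $f_{\mathbf{a}_1,\mathbf{b}_1}, \ldots, f_{\mathbf{a}_h,\mathbf{b}_h}$ forming part of a minimal system of homogeneous generators of $I_{\mathcal{P}}$ and a monomial order $<$ on $S$ such that $\mathrm{in}_<(f_{\mathbf{a}_1,\mathbf{b}_1}), \ldots, \mathrm{in}_<(f_{\mathbf{a}_h,\mathbf{b}_h})$ is a regular sequence. *)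

(* Defs.v *)
From mathcomp Require Import all_boot all_order all_algebra.
From mathcomp Require Import finmap mpoly.

Set Implicit Arguments.
Unset Strict Implicit.
Unset Printing Implicit Defensive.

Import GRing.Theory.

Local Open Scope fset_scope.
Local Open Scope ring_scope.

(* The cell [a, a + (1, 1)] is represented by its lower left corner a.  The
   definitions below are used both in N^2 and in Z^2, hence the semiring R. *)
Section Cells.
Variable R : nzSemiRingType.
Implicit Types a C D : R * R.

Definition cell_vertices a : {fset R * R} :=
  [fset a; a + (1, 0); a + (0, 1); a + (1, 1)].

Definition cell_edges a : seq {fset R * R} :=
  [:: [fset a; a + (1, 0)]; [fset a; a + (0, 1)];
      [fset a + (1, 0); a + (1, 1)]; [fset a + (0, 1); a + (1, 1)]].

Definition share_edge : rel (R * R) :=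
  fun C D => cell_vertices C `&` cell_vertices D \in cell_edges C.

Definition edge_connected (Q : {pred R * R}) : Prop :=
  {in Q &, forall C D, exists s : seq (R * R),
    [/\ path share_edge C s, all (mem Q) s & last C s = D]}.

End Cells.

Section Polyomino.
Implicit Types (P : {fset nat * nat}) (a b v C : nat * nat).

Definition polyomino P : Prop := edge_connected (mem P).

Definition cells_in_Z2 P : {fset int * int} :=
  [fset (C.1%:Z, C.2%:Z) | C in P].

Definition simple_polyomino P : Prop :=
  polyomino P /\ edge_connected [pred C : int * int | C \notin cells_in_Z2 P].

Definition vertices P : {fset nat * nat} := \bigcup_(C <- P) cell_vertices C.

Definition le2 a b : bool := ((a.1 <= b.1) && (a.2 <= b.2))%N.

Definition proper_interval a b : bool := ((a.1 < b.1) && (a.2 < b.2))%N.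

Definition inner_interval P a b : Prop :=
  proper_interval a b /\
  forall C, le2 a C -> le2 (C + (1, 1)) b -> C \in P.

Definition free_vertex P v : bool :=
  #|` [fset C in P | v \in cell_vertices C]| == 1%N.

(* At least two free vertices: a polyomino with only one cell is a tree. *)
Definition leaf P C : bool :=
  (C \in P) && (2 <= #|` [fset v in cell_vertices C | free_vertex P v]|)%N.

Definition tree_polyomino P : Prop :=
  [/\ simple_polyomino P,
      exists C, leaf P C
    & forall a, ~ inner_interval P a (a + (2, 2))].

End Polyomino.

(* Ideals are arbitrary predicates, not the boolean ones of ring_quotient. *)
Section Ideals.
Variable R : comNzRingType.
Implicit Types (I J p : R -> Prop) (s : seq R).

Definition is_ideal I : Prop :=
  [/\ I 0, forall u v, I u -> I v -> I (u + v) & forall u v, I v -> I (u * v)].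

Definition is_prime_ideal p : Prop :=
  [/\ is_ideal p, ~ p 1 & forall u v, p (u * v) -> p u \/ p v].

Definition sub_ideal I J : Prop := forall u, I u -> J u.

Definition same_ideal I J : Prop := forall u, I u <-> J u.

Definition ideal_gen (G : R -> Prop) : R -> Prop := fun u =>
  exists t : seq (R * R),
    (forall cg, cg \in t -> G cg.2) /\ u = \sum_(cg <- t) cg.1 * cg.2.

Definition prime_chain p (n : nat) : Prop :=
  exists c : nat -> R -> Prop,
    [/\ forall i, (i <= n)%N -> is_prime_ideal (c i),
        forall i, (i < n)%N -> sub_ideal (c i) (c i.+1) /\
                               ~ sub_ideal (c i.+1) (c i)
      & same_ideal (c n) p].

(* height I = min {height p | p prime, I \subset p}, where height p is the
   largest length of a chain of primes ending at p. *)
Definition is_height I (h : nat) : Prop :=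
  (forall p, is_prime_ideal p -> sub_ideal I p -> prime_chain p h) /\
  (exists p, [/\ is_prime_ideal p, sub_ideal I p & ~ prime_chain p h.+1]).

Definition regular_sequence s : Prop :=
  (forall i, (i < size s)%N -> forall u,
     ideal_gen (fun g => g \in take i s) (s`_i * u) ->
     ideal_gen (fun g => g \in take i s) u) /\
  ~ ideal_gen (fun g => g \in s) 1.

End Ideals.

Section MonomialOrder.
Variable n : nat.

Definition monomial_order (le : rel 'X_{1..n}) : Prop :=
  [/\ total le, transitive le, antisymmetric le, forall m, le 0%MM m
    & forall m m1 m2, le m1 m2 -> le (m + m1)%MM (m + m2)%MM].

(* As for mlead, with the order le in place of degrevlex. *)
Definition initial_monomial (K : fieldType) (le : rel 'X_{1..n})
    (f : {mpoly K[n]}) : {mpoly K[n]} :=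
  'X_[\big[(fun m1 m2 => if le m1 m2 then m2 else m1)/0%MM]_(m <- msupp f) m].

Definition minimal_homogeneous_generators (K : fieldType)
    (I : {mpoly K[n]} -> Prop) (G : seq {mpoly K[n]}) : Prop :=
  [/\ all (fun f => f \is homog mdeg) G,
      same_ideal (ideal_gen (fun g => g \in G)) I
    & forall g, g \in G ->
        ~ same_ideal (ideal_gen (fun f => f \in G /\ f != g)) I].

End MonomialOrder.

Section PolyominoIdeal.
Variables (K : fieldType) (P : {fset nat * nat}).

(* The variables x_a, a \in V(P), are numbered along an enumeration of V(P). *)
Definition polyomino_ring := {mpoly K[#|{: vertices P}|]}.

(* 0 is a dummy value, used only when a is not in V(P). *)
Definition xvar (a : nat * nat) : polyomino_ring :=
  if insub a is Some v then 'X_(enum_rank (v : vertices P)) else 0.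

Definition minor (ab : (nat * nat) * (nat * nat)) : polyomino_ring :=
  let: (a, b) := ab in
  xvar a * xvar b - xvar (b.1, a.2) * xvar (a.1, b.2).

Definition inner_minor (f : polyomino_ring) : Prop :=
  exists a b, inner_interval P a b /\ f = minor (a, b).

Definition polyomino_ideal : polyomino_ring -> Prop := ideal_gen inner_minor.

Definition konig_type : Prop :=
  exists2 h : nat, is_height polyomino_ideal h &
  exists (ab : seq ((nat * nat) * (nat * nat))) (G : seq polyomino_ring)
      (le : rel 'X_{1..#|{: vertices P}|}),
    [/\ size ab = h /\ (forall a b, (a, b) \in ab -> inner_interval P a b),
        minimal_homogeneous_generators polyomino_ideal G,
        uniq (map minor ab) /\ {subset map minor ab <= G},
        monomial_order le
      & regular_sequence [seq initial_monomial le f | f <- map minor ab]].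

End PolyominoIdeal.

(* Main.v *)
From HB Require Import structures.
Require Import Defs.
From mathcomp Require Import all_boot all_order all_algebra.
From mathcomp Require Import finmap mpoly.
From mathcomp Require Import ring_quotient fraction zify.
From Stdlib Require Import Classical ClassicalEpsilon.

Set Implicit Arguments.
Unset Strict Implicit.
Unset Printing Implicit Defensive.

Import Order.TTheory GRing.Theory Num.Theory.
Local Open Scope ring_scope.

(** The cells of a tree can be listed so that each new cell [C] shares an edge with exactly
    one earlier cell and its two other vertices are new: otherwise there is a closed walk of
    cells crossing some edge exactly once, or two cells touching at a vertex only, and the
    parity of the crossings of this walk with a ray (a discrete winding number, constant on
    the connected complement) gives a contradiction.  Hence #V = 2 #P + 2.

    Call [curv w C] the alternating sum of a function [w] on the corners of [C]; the
    alternating sum over the corners of an interval is the sum of the [curv w C] over its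
    cells, and the list of cells shows that [curv w] can be prescribed arbitrarily.

    Koenig data: use the diagonal corners of the maximal horizontal strips of cells and the
    anti-diagonal corners of the maximal vertical ones.  Looking at the four cells around a
    vertex, each vertex is used at most once, so these monomials are pairwise coprime.  Every
    cell is the first cell, in the list, of one maximal strip at least; choosing [curv w] with
    the right sign and rapidly decreasing along the list, the weight [w] makes the chosen
    monomials initial.

    Height: let [p] be a prime containing the ideal.  Modulo [p] every monomial is congruent to
    one divisible by no initial monomial, so counting monomials shows that at most #V - #P
    variables are algebraically independent modulo [p]; a maximal independent set of variables
    yields a chain of #P primes below [p].  Conversely, prescribing [curv w = 0] gives a toric
    prime containing the ideal, modulo which #V - #P variables are independent, and along a
    chain of primes the number of independent variables strictly increases downwards. *)

(** * Residue fields of prime ideals *)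

Section PrimeQuotient.
Variables (R : comNzRingType) (p : R -> Prop).
Hypothesis pP : is_prime_ideal p.

(** The quotient construction takes a boolean ideal; excluded middle turns the arbitrary predicate
    [p] into one. *)
Let pb : pred R := fun u => if excluded_middle_informative (p u) then true else false.

Let pbP u : reflect (p u) (u \in pb).
Proof.
by rewrite unfold_in /pb; case: excluded_middle_informative => h; constructor.
Qed.

Let pb_idealr : idealr_closed pb.
Proof.
have [[p0 pD pM] p1 _] := pP; split; first exact/pbP.
- exact/pbP.
- by move=> a u v /pbP pu /pbP pv; apply/pbP/pD => //; apply: pM.
Qed.

Let pb_prime : prime_idealr_closed pb.
Proof.
have [_ _ pr] := pP => u v /pbP /pr [] h; apply/orP; [left|right]; exact/pbP.
Qed.

HB.instance Definition _ := isIdealr.Build R pb pb_idealr.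
HB.instance Definition _ := isPrimeIdealrClosed.Build R pb pb_prime.

Let I : prime_idealr R := pb.
Let Q := Quotient.quot I.

HB.instance Definition _ := GRing.ComNzRing.on Q.

(** Inverses are chosen classically: a unit ring structure has to be in place before the quotient
    becomes a domain with a fraction field. *)
Let Q_unit : pred Q := fun x => if excluded_middle_informative (exists y, y * x = 1)
  then true else false.

Let Q_inv (x : Q) : Q := 
  if excluded_middle_informative (exists y, y * x = 1) is left h
  then proj1_sig (constructive_indefinite_description _ h) else x.

Let Q_mulVx : {in Q_unit, left_inverse 1 Q_inv *%R}.
Proof.
move=> x; rewrite unfold_in /Q_unit /Q_inv.
case: excluded_middle_informative => // h _.
by case: constructive_indefinite_description.
Qed.

Let Q_unitP x y : y * x = 1 -> Q_unit x.
Proof. by move=> yx; rewrite /Q_unit; case: excluded_middle_informative => // -[]; exists y. Qed.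

Let Q_inv_out : {in [predC Q_unit], Q_inv =1 id}.
Proof.
move=> x; rewrite inE unfold_in /Q_unit /Q_inv.
by case: excluded_middle_informative.
Qed.

HB.instance Definition _ := GRing.ComNzRing_hasMulInverse.Build Q Q_mulVx Q_unitP Q_inv_out.
HB.instance Definition _ := GRing.ComUnitRing_isIntegral.Build Q (@Quotient.rquot_IdomainAxiom R I).

(** The morphism projects to the quotient and embeds this domain in its fraction field. Later
    arguments use such a field-valued morphism in place of the prime. *)
Lemma prime_ideal_kernel :
  exists (E : fieldType) (f : {rmorphism R -> E}), forall u, p u <-> f u = 0.
Proof.
pose g : {rmorphism R -> Q} := (\pi_Q)%qT.
exists {fraction Q}, (@tofrac Q \o g) => u /=; rewrite -tofrac0.
have -> : (@tofrac Q (g u) = @tofrac Q 0) <-> g u = 0.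
  by split=> [/eqP|->//]; rewrite tofrac_eq => /eqP.
have -> : g u = 0 <-> u \in pb.
  rewrite -(rmorph0 g); split.
    by move/eqP; rewrite -Quotient.idealrBE subr0.
  by move=> h; apply/eqP; rewrite -Quotient.idealrBE subr0.
by split=> /pbP.
Qed.

End PrimeQuotient.

(** * Chains of primes in polynomial rings *)

Lemma kernel_prime (R : comNzRingType) (S : idomainType) (f : {rmorphism R -> S}) :
  is_prime_ideal (fun u => f u = 0).
Proof.
split; first split.
- exact: rmorph0.
- by move=> u v fu fv; rewrite rmorphD fu fv addr0.
- by move=> u v fv; rewrite rmorphM fv mulr0.
- by move/eqP; rewrite rmorph1 oner_eq0.
- move=> u v /eqP; rewrite rmorphM mulf_eq0.
  by case/orP => /eqP; [left|right].
Qed.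

(** The smallest primes are dropped, since the chain must keep ending at [p]. *)
Lemma prime_chain_trim (R : comNzRingType) (p : R -> Prop) m n :
  (n <= m)%N -> prime_chain p m -> prime_chain p n.
Proof.
move=> le_nm [c [cP cS cE]]; exists (fun i => c (i + (m - n))%N); split.
- by move=> i le_in; apply: cP; rewrite -{2}(subnKC le_nm) leq_add2r.
- by move=> i lt_in; apply: cS; rewrite -{2}(subnKC le_nm) ltn_add2r.
- by rewrite subnKC.
Qed.

(** * Polynomials in a subset of the variables *)

Section Supports.
Variables (n : nat) (K : fieldType).
Implicit Types (f g : {mpoly K[n]}) (q : {mpoly K[n]} -> Prop) (A B : {set 'I_n}).

Lemma mpoly_rmorph_eq (S : comNzRingType) (g h : {rmorphism {mpoly K[n]} -> S}) :
  (forall c, g c%:MP = h c%:MP) -> (forall i, g 'X_i = h 'X_i) -> g =1 h.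
Proof.
move=> eqC eqX f; rewrite (mpolyE f) !rmorph_sum; apply: eq_bigr => m _.
rewrite -mul_mpolyC !rmorphM eqC mpolyXE_id !rmorph_prod; congr (_ * _).
by apply: eq_bigr => i _; rewrite !rmorphXn eqX.
Qed.

Definition supported B f := forall m, m \in msupp f -> forall i, i \notin B -> m i = 0%N.

(** For a prime [q] this is algebraic independence, modulo [q], of the variables in [B]. *)
Definition independent B q := forall f, supported B f -> q f -> f = 0.

(** Gives the retraction of the polynomial ring onto K[x_B] killing the other variables, so that
    K[x_B] can be handled without introducing another ring. *)
Definition restr_var B (i : 'I_n) : {mpoly K[n]} := if i \in B then 'X_i else 0.
Definition restr B : {rmorphism {mpoly K[n]} -> {mpoly K[n]}} :=
  mmap (@mpolyC n K) (restr_var B).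

Lemma restr_C B c : restr B c%:MP = c%:MP.
Proof. by rewrite /restr /= mmapC. Qed.

Lemma restr_var_E B i : restr B 'X_i = restr_var B i.
Proof. by rewrite /restr /= mmapX mmap1U. Qed.

Lemma restr_Xm B m : restr B 'X_[m] =
  if [forall i, (i \notin B) ==> (m i == 0%N)] then 'X_[m] else 0.
Proof.
rewrite {1}mpolyXE_id rmorph_prod /=; case: ifP => [/forallP h|].
  rewrite mpolyXE_id; apply: eq_bigr => i _; rewrite rmorphXn /= restr_var_E /restr_var.
  by case: ifP => // /negbT iB; move: (h i); rewrite iB => /eqP ->; rewrite !expr0.
move/negbT; rewrite negb_forall => /existsP[i]; rewrite negb_imply => /andP[iB mi].
by rewrite (bigD1 i) //= rmorphXn /= restr_var_E /restr_var (negPf iB) expr0n (negPf mi) mul0r.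
Qed.

Lemma supported_restr B f : supported B (restr B f).
Proof.
move=> m; rewrite (mpolyE f) rmorph_sum /= => /msupp_sum_le /flattenP[s].
case/mapP => m' _ ->; rewrite -mul_mpolyC rmorphM /= restr_C restr_Xm.
case: ifP => [/forallP h|_]; last by rewrite mulr0 msupp0.
rewrite mul_mpolyC => /msuppZ_le; rewrite msuppX inE => /eqP -> i iB.
by move: (h i); rewrite iB => /eqP.
Qed.

Lemma restr_id B f : supported B f -> restr B f = f.
Proof.
move=> sf; rewrite {1}(mpolyE f) rmorph_sum /= [RHS]mpolyE.
rewrite !big_seq; apply: eq_bigr => m mf; rewrite -mul_mpolyC rmorphM /= restr_C restr_Xm.
case: ifP => [_|/negbT]; first by rewrite mul_mpolyC.
by rewrite negb_forall => /existsP[i]; rewrite negb_imply => /andP[iB]; rewrite (sf m).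
Qed.

Lemma supportedS A B f : A \subset B -> supported A f -> supported B f.
Proof. by move=> /subsetP sAB sf m mf i /(contra (sAB i)); apply: sf. Qed.

End Supports.

(* [gauss pi A] reduces modulo the kernel of [pi] the variables indexed by [A] and the
   constants only; its kernel is the extension of the contraction of that ideal to K[x_A]. *)
Section Extensions.
Variables (n : nat) (K E : fieldType) (pi : {rmorphism {mpoly K[n]} -> E}).
Implicit Types (f g : {mpoly K[n]}) (A B : {set 'I_n}).

Let piC : {rmorphism K -> {mpoly E[n]}} := @mpolyC n E \o (pi \o @mpolyC n K).

Definition gauss_var A (i : 'I_n) : {mpoly E[n]} := if i \in A then (pi 'X_i)%:MP else 'X_i.

Definition gauss A : {rmorphism {mpoly K[n]} -> {mpoly E[n]}} := mmap piC (gauss_var A).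

Lemma gauss_C A c : gauss A c%:MP = (pi c%:MP)%:MP.
Proof. by rewrite /gauss /= mmapC. Qed.

Lemma gauss_X A i : gauss A 'X_i = gauss_var A i.
Proof. by rewrite /gauss /= mmapX mmap1U. Qed.

Lemma gauss_setT f : gauss setT f = (pi f)%:MP.
Proof.
pose h : {rmorphism {mpoly K[n]} -> {mpoly E[n]}} := @mpolyC n E \o pi.
apply: (@mpoly_rmorph_eq n K _ (gauss setT) h) => [c|i]; first by rewrite gauss_C.
by rewrite gauss_X /gauss_var inE.
Qed.

(** [gauss pi B] factors through [gauss pi A]: the map [ev] evaluates the remaining variables of [B]
    at their residues. *)
Lemma gaussS A B f : A \subset B -> gauss A f = 0 -> gauss B f = 0.
Proof.
move=> /subsetP sAB.
pose ev : {rmorphism {mpoly E[n]} -> {mpoly E[n]}} := mmap (@mpolyC n E) (gauss_var B).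
have -> : gauss B f = (ev \o gauss A) f.
  apply: (@mpoly_rmorph_eq n K _ (gauss B) (ev \o gauss A)) => [c|i].
    by rewrite /= !gauss_C /ev /= mmapC.
  rewrite -[RHS]/(ev (gauss A 'X_i)) !gauss_X [gauss_var A i]/gauss_var; case: ifP => [iA|_].
    by rewrite /ev /= mmapC /gauss_var (sAB _ iA).
  by rewrite /ev /= mmapX mmap1U.
by rewrite /= => ->; rewrite rmorph0.
Qed.

Lemma gauss_Xm A m : gauss A 'X_[m] =
   pi (\prod_i (if i \in A then 'X_i else 1) ^+ m i)
     *: 'X_[[multinom (if i \in A then 0 else m i)%N | i < n]].
Proof.
rewrite {1}mpolyXE_id -mul_mpolyC mpolyXE_id !rmorph_prod -big_split /=.
apply: eq_bigr => i _; rewrite mnmE !rmorphXn /= gauss_X /gauss_var.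
by case: ifP => _; rewrite ?rmorph1 ?expr0 ?mulr1 ?expr1n ?mul1r.
Qed.

Lemma gauss_supported A f : supported A f -> gauss A f = (pi f)%:MP.
Proof.
move=> sf; rewrite (mpolyE f) !rmorph_sum /= big_seq [RHS]big_seq; apply: eq_bigr => m mf.
rewrite -mul_mpolyC !rmorphM /= gauss_C gauss_Xm; congr (_ * _).
have -> : [multinom (if i \in A then 0 else m i)%N | i < n] = 0%MM.
  by apply/mnmP => i; rewrite mnmE mnm0E; case: ifP => // /negbT/(sf m mf).
rewrite mpolyX0 -mul_mpolyC mulr1; congr (pi _)%:MP.
rewrite mpolyXE_id; apply: eq_bigr => i _; case: ifP => // /negbT/(sf m mf) ->.
by rewrite !expr0.
Qed.

(** Regard [f] as a polynomial over K[x_A] in the other variables: its nonzero coefficients stay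
    nonzero under [pi], by independence. *)
Lemma gauss_inj A f : independent A (fun f => pi f = 0) -> gauss A f = 0 -> f = 0.
Proof.
move=> indA; apply: contra_eq => nzf.
have [m0 m0f] : exists m0, m0 \in msupp f.
  by case: (msupp f) (msupp_eq0 f) => [|m s _]; rewrite ?(negPf nzf) //; exists m; rewrite inE eqxx.
pose out (m : 'X_{1..n}) := [multinom (if i \in A then 0 else m i)%N | i < n].
pose inn (m : 'X_{1..n}) := [multinom (if i \in A then m i else 0)%N | i < n].
have inn_out m m' : out m = out m' -> inn m = inn m' -> m = m'.
  move=> ho hi; apply/mnmP => i.
  move: (congr1 (fun m : 'X_{1..n} => m i) ho) (congr1 (fun m : 'X_{1..n} => m i) hi).
  by rewrite !mnmE; case: ifP.
have prodE (m : 'X_{1..n}) : \prod_i (if i \in A then 'X_i else 1) ^+ m i = 'X_[inn m] :> {mpoly K[n]}.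
  rewrite mpolyXE_id; apply: eq_bigr => i _; rewrite mnmE.
  by case: ifP; rewrite ?expr1n.
(* The coefficient, in K[x_A], of the monomial [out m0] of [f]. *)
pose f0 := \sum_(m <- msupp f | out m == out m0) f@_m *: 'X_[inn m] : {mpoly K[n]}.
have f0_supp : supported A f0.
  move=> m /msupp_sum_le /flattenP[s /mapP[m' _ ->]] /msuppZ_le.
  by rewrite msuppX inE => /eqP -> i iA; rewrite mnmE (negPf iA).
have f0_nz : f0 != 0.
  apply/negP => /eqP/(congr1 (mcoeff (inn m0))); rewrite mcoeff0 /f0 raddf_sum /= -big_filter.
  rewrite (bigD1_seq m0) /= ?mem_filter ?eqxx ?filter_uniq ?msupp_uniq //.
  rewrite mcoeffZ mcoeffX eqxx mulr1 big_seq_cond big1 ?addr0.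
    by apply/eqP; rewrite -mcoeff_msupp.
  move=> m /andP[]; rewrite mem_filter => /andP[/eqP om _] ne.
  rewrite mcoeffZ mcoeffX; case: eqP => [im|_]; last by rewrite mulr0.
  by rewrite (inn_out _ _ om im) eqxx in ne.
have : pi f0 != 0 by apply: contraNneq f0_nz => h; apply/eqP/indA.
apply: contraNN => /eqP/(congr1 (mcoeff (out m0))); rewrite mcoeff0 => <-.
have -> : gauss A f = \sum_(m <- msupp f) gauss A (f@_m *: 'X_[m]).
  by rewrite {1}(mpolyE f); apply: (rmorph_sum (gauss A)).
rewrite /f0 !raddf_sum big_mkcond.
apply/eqP; apply: eq_bigr => m _; rewrite -!mul_mpolyC !rmorphM /= gauss_C gauss_Xm prodE -/(out m).
rewrite mcoeffCM mcoeffZ mcoeffX.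
by case: eqP => _; rewrite ?rmorphM ?mulr1 // !mulr0.
Qed.

End Extensions.

(** * Long chains below a prime *)

Section PrimeChains.
Variables (n : nat) (K : fieldType).
Implicit Types (f g : {mpoly K[n]}) (p q : {mpoly K[n]} -> Prop) (A B : {set 'I_n}).

Lemma independent_sub p q B : sub_ideal q p -> independent B p -> independent B q.
Proof. by move=> sqp indB f sf qf; apply: indB => //; apply: sqp. Qed.

Lemma dependentP p B : ~ independent B p -> exists f, [/\ supported B f, p f & f != 0].
Proof.
move=> depB; apply: NNPP => nex; apply: depB => f sf pf.
by apply/eqP; apply: contra_notT nex => nz; exists f.
Qed.

Lemma independent0 p : is_prime_ideal p -> independent set0 p.
Proof.
move=> [[_ _ pM] p1 _] f sf pf; apply/eqP; apply: contra_notT p1 => nz.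
have fE : f = (f@_0%MM)%:MP.
  apply/mpolyP => m; rewrite mcoeffC; have [->|nzm] := eqVneq m 0%MM; first by rewrite mulr1.
  rewrite mulr0; apply: memN_msupp_eq0; apply: contraNN nzm => mf.
  by apply/eqP/mnmP => i; rewrite mnm0E (sf m mf) ?inE.
have nz0 : f@_0%MM != 0 by apply: contraNneq nz => h; rewrite fE h mpolyC0.
have -> : 1 = (f@_0%MM)^-1%:MP * f :> {mpoly K[n]}.
  by rewrite {2}fE -mpolyCM mulVf.
exact: pM.
Qed.

Lemma maximal_independent p : is_prime_ideal p ->
  exists2 B, independent B p & forall i, i \notin B -> ~ independent (i |: B) p.
Proof.
move=> pP; suff: forall k B, (#|~: B| <= k)%N -> independent B p ->
    exists2 B, independent B p & forall i, i \notin B -> ~ independent (i |: B) p.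
  by move/(_ _ set0 (leqnn _)); apply; apply: independent0.
elim=> [|k IHk] B.
  rewrite leqn0 cards_eq0 => /eqP B0 indB; exists B => // i iB.
  by have := in_set0 i; rewrite -B0 inE iB.
move=> leBk indB.
case: (classic (exists2 i, i \notin B & independent (i |: B) p)) => [[i iB indiB]|nex].
  apply: IHk indiB; rewrite -ltnS; apply: leq_trans leBk.
  by apply/proper_card/properP; split; [rewrite setCS subsetUr | exists i; rewrite !inE ?eqxx].
by exists B => // i iB indiB; apply: nex; exists i.
Qed.

Lemma gauss_agree (E : fieldType) (pi : {rmorphism {mpoly K[n]} -> E}) A B C f :
  supported C f -> A :&: C = B :&: C -> gauss pi A f = gauss pi B f.
Proof.
move=> sf /setP eqAB; rewrite /gauss /= /mmap !big_seq; apply: eq_bigr => m mf.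
congr (_ * _); apply: eq_bigr => i _; case: (boolP (i \in C)) => [iC|/(sf m mf) ->].
  by have:= eqAB i; rewrite !inE iC !andbT /gauss_var => ->.
by rewrite !expr0.
Qed.

(** Take a maximal independent set [B] and adjoin the other variables one at a time. The kernels of
    the corresponding maps [gauss] increase strictly up to [p], in as many steps as there are
    variables outside [B]. *)
Lemma prime_chain_ge p h : is_prime_ideal p ->
  (forall B, independent B p -> #|B| + h <= n)%N -> prime_chain p h.
Proof.
move=> pP bound; have [B indB maxB] := maximal_independent pP.
have [E [pi piP]] := prime_ideal_kernel pP.
apply: (@prime_chain_trim _ _ #|~: B|).
  by rewrite cardsCs setCK card_ord leq_subRL ?bound //; apply: leq_trans (bound _ indB); rewrite leq_addr.
pose s := enum (~: B); pose A j := B :|: [set i in take j s].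
have sB i : (i \in s) = (i \notin B) by rewrite mem_enum inE.
exists (fun j f => gauss pi (A j) f = 0); split.
- by move=> j _; apply: kernel_prime.
- move=> j; rewrite cardE -/s => ltjs.
  have [x0 _] : exists x0, x0 \in s by case: (s) ltjs => // x s' _; exists x; apply: mem_head.
  pose i0 := nth x0 s j; have i0s : i0 \in s by apply: mem_nth.
  have takeS k : (k \in take j.+1 s) = (k == i0) || (k \in take j s).
    by rewrite (take_nth x0) // mem_rcons inE.
  split=> [f|].
    apply: gaussS; apply: setUS; apply/subsetP => k; rewrite !inE takeS => ->.
    by rewrite orbT.
  have i0B : i0 \notin B by rewrite -sB.
  (* By maximality of [B], the variable [i0] satisfies a relation [f] over K[x_B] modulo [p]. This
     [f] enters the kernel when [i0] is adjoined; before that, the map agrees on [f] with the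
     injective [gauss pi B]. *)
  have [f [sf pf nzf]] := dependentP (maxB i0 i0B).
  move/(_ f) => sub; apply/negP: nzf; rewrite negbK; apply/eqP.
  apply: (@gauss_inj _ _ _ pi B).
    by apply: independent_sub indB => u /piP.
  have i0T : i0 \notin take j s.
    have : uniq (take j s ++ drop j s) by rewrite cat_take_drop enum_uniq.
    rewrite cat_uniq => /and3P[_ /hasPn dj _]; apply: dj.
    by rewrite (drop_nth x0 ltjs) inE eqxx.
  rewrite -(@gauss_agree _ pi (A j) B _ _ sf) ?sub //.
    rewrite (gauss_supported pi (@supportedS _ _ _ (A j.+1) _ _ sf)).
      by rewrite (piP f).1 // mpolyC0.
    by apply/subsetP => k; rewrite !inE takeS => /orP[->|->]; rewrite ?orbT.
  apply/setP => k; rewrite !inE; have [->|_] := eqVneq k i0.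
    by rewrite (negPf i0B) (negPf i0T).
  by case: (k \in B); rewrite ?andbF.
- move=> f; suff -> : A #|~: B| = setT.
    rewrite gauss_setT piP; split=> [/eqP|->]; last by rewrite mpolyC0.
    by rewrite mpolyC_eq0 => /eqP.
  apply/setP => i; rewrite !inE cardE -/s take_size.
  by rewrite sB orbN.
Qed.

End PrimeChains.

(** * Integral equations over the image of a morphism *)

Section Integrality.
Variables (R : comNzRingType) (E : fieldType) (phi : {rmorphism R -> E}).

(** Multiplying the equation by a power of the leading coefficient makes it monic in the product of
    [x] and that coefficient. *)
Lemma integral_lead_coef (P : {poly R}) x :
  root (map_poly phi P) x -> phi (lead_coef P) != 0 ->
  integralOver phi (phi (lead_coef P) * x).
Proof.
set a := lead_coef P => rootx nza.
have [d sP] : exists d, size P = d.+2.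
  move: rootx nza; rewrite /a lead_coefE /root; case sP: (size P) => [|[|d]]; last by exists d.
    by rewrite nth_default ?sP //= rmorph0 eqxx.
  by rewrite (size1_polyC (eq_leq sP)) map_polyC hornerC coefC /= => /eqP ->; rewrite eqxx.
(* With [P] of degree d + 1, [q] is chosen so that q(aX) = a^d P(X). *)
pose q : {poly R} := \poly_(j < d.+2) (if j == d.+1 then 1 else a ^+ (d - j) * P`_j).
exists q; first by rewrite monicE lead_coef_poly ?eqxx ?oner_neq0.
have sq : (size (map_poly phi q) <= d.+2)%N.
  by rewrite (leq_trans (size_poly _ _)) // size_poly.
have sP' : (size (map_poly phi P) <= d.+2)%N by rewrite -sP size_poly.
apply/rootP; rewrite (horner_coef_wide _ sq) big_ord_recr /=.
move/rootP: rootx; rewrite (horner_coef_wide _ sP') big_ord_recr /=.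
have Pd : P`_d.+1 = a by rewrite /a lead_coefE sP.
have qd : q`_d.+1 = 1 by rewrite coef_poly ltnSn eqxx.
rewrite !coef_map /= Pd qd rmorph1 mul1r.
move=> root_x.
rewrite -[RHS](mulr0 (phi a ^+ d)) -[in RHS]root_x mulrDr mulr_sumr; congr (_ + _); last first.
  by rewrite exprMn [phi a ^+ d.+1]exprSr mulrA.
apply: eq_bigr => j _; have ltj := ltn_ord j.
have -> : (map_poly phi q)`_j = phi (a ^+ (d - j) * P`_j).
  by rewrite coef_map coef_poly ltnW // ltn_eqF.
rewrite coef_map /=.
rewrite rmorphM rmorphXn exprMn -mulrA [RHS]mulrCA [LHS]mulrCA; congr (_ * _).
by rewrite mulrA -exprD subnK // -ltnS.
Qed.

(** As [z] is nonzero, a monic equation with vanishing constant term can be divided by [z]; this is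
    repeated until the constant term survives. *)
Lemma integral_const_coef z : z != 0 -> integralOver phi z ->
  exists (Q : {poly R}) c, (map_poly phi Q).[z] * z + phi c = 0 /\ phi c != 0.
Proof.
move=> nz [Q]; elim/poly_ind: Q => [|Q c IHQ].
  by rewrite monicE lead_coef0 eq_sym oner_eq0.
move=> monQ; rewrite /root rmorphD rmorphM /= map_polyX map_polyC /= hornerD hornerMX hornerC => /eqP rootz.
have [phic|] := eqVneq (phi c) 0; last by exists Q, c.
apply: IHQ.
  move: monQ; rewrite !monicE; have [->|nzQ] := eqVneq Q 0.
    rewrite mul0r add0r lead_coefC => /eqP c1.
    by move/eqP: phic; rewrite c1 rmorph1 oner_eq0.
  rewrite lead_coefDl ?lead_coefMX // size_mulX // (leq_ltn_trans (size_polyC_leq1 c)) //.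
  by rewrite ltnS size_poly_gt0.
move/eqP: rootz; rewrite phic addr0 mulf_eq0 (negPf nz) orbF.
by [].
Qed.

End Integrality.

(** * Independent variables along a strict inclusion of primes *)

Section Step.
Variables (n : nat) (K : fieldType).
Implicit Types (f g : {mpoly K[n]}) (p q : {mpoly K[n]} -> Prop) (A B : {set 'I_n}).

Section Algebraic.
Variables (E : fieldType) (pi : {rmorphism {mpoly K[n]} -> E}) (B : {set 'I_n}).
(** The image of [phi] is the residue of K[x_B], so [integralOver phi] is integrality over that
    subring. *)
Let phi : {rmorphism {mpoly K[n]} -> E} := pi \o restr K B.

Definition dep_var i j : {poly {mpoly K[n]}} :=
  if j \in B then ('X_j)%:P else if j == i then 'X else 0.

(* [f] viewed as a polynomial in [x_i] with coefficients in K[x_B]. *)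
Definition as_univariate i : {rmorphism {mpoly K[n]} -> {poly {mpoly K[n]}}} :=
  mmap (@polyC {mpoly K[n]} \o @mpolyC n K) (dep_var i).

Lemma as_univariate_C i c : as_univariate i c%:MP = c%:MP%:P.
Proof. by rewrite /as_univariate /= mmapC. Qed.

Lemma as_univariate_X i j : as_univariate i 'X_j = dep_var i j.
Proof. by rewrite /as_univariate /= mmapX mmap1U. Qed.

Lemma horner_as_univariate i f : i \notin B -> (as_univariate i f).['X_i] = restr K (i |: B) f.
Proof.
move=> iB; pose h : {rmorphism _ -> _} := horner_eval ('X_i : {mpoly K[n]}) \o as_univariate i.
apply: (@mpoly_rmorph_eq n K _ h (restr K (i |: B))) => [c|j].
  by rewrite restr_C /= as_univariate_C /horner_eval hornerC.
rewrite restr_var_E /= as_univariate_X /horner_eval /dep_var /restr_var !inE.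
case: (boolP (j \in B)) => jB; first by rewrite hornerC orbT.
by have [->|_] := eqVneq j i; rewrite ?hornerX ?horner0.
Qed.

Lemma as_univariate_restr i f : map_poly (restr K B) (as_univariate i f) = as_univariate i f.
Proof.
pose h : {rmorphism _ -> _} := map_poly (restr K B) \o as_univariate i.
apply: (@mpoly_rmorph_eq n K _ h (as_univariate i)) => [c|j].
  by rewrite /h [LHS]/= !as_univariate_C map_polyC /= restr_C.
rewrite /h [LHS]/= !as_univariate_X /dep_var; case: ifP => jB.
  by rewrite map_polyC /= restr_var_E /restr_var jB.
by case: ifP => _; rewrite ?map_polyX ?rmorph0.
Qed.

Hypothesis indB : independent B (fun f => pi f = 0).
Hypothesis depB : forall i, i \notin B -> ~ independent (i |: B) (fun f => pi f = 0).

Lemma pi_neq0 c : restr K B c = c -> c != 0 -> pi c != 0.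
Proof.
by move=> rc; apply: contraNneq => pc; apply/eqP/indB => //; rewrite -rc; exact: supported_restr.
Qed.

(** Outside [B], the multiplier is the leading coefficient in x_i of a relation over K[x_B]; it is
    nonzero in the residue field because [B] is independent. *)
Lemma integral_variable i : exists c,
  [/\ restr K B c = c, pi c != 0 & integralOver phi (pi (c * 'X_i))].
Proof.
have [iB|iB] := boolP (i \in B).
  exists 1; rewrite !rmorph1 mul1r oner_neq0; split=> //.
  have -> : pi 'X_i = phi 'X_i by rewrite /phi /= restr_var_E /restr_var iB.
  exact: integral_id.
have [f [sf pf nzf]] := dependentP (depB iB).
have rf : restr K (i |: B) f = f by apply: restr_id.
set P := as_univariate i f; have rP : map_poly (restr K B) P = P by apply: as_univariate_restr.
have nzP : P != 0.
  by apply: contraNneq nzf => P0; rewrite -rf -horner_as_univariate // -/P P0 horner0.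
have rl : restr K B (lead_coef P) = lead_coef P.
  by rewrite !lead_coefE -coef_map rP.
have nzl : pi (lead_coef P) != 0 by rewrite pi_neq0 // lead_coef_eq0.
have phil : phi (lead_coef P) = pi (lead_coef P) by rewrite /phi /= rl.
exists (lead_coef P); split=> //; rewrite rmorphM -phil.
apply: integral_lead_coef; last by rewrite phil.
apply/rootP; rewrite map_poly_comp rP horner_map -[RHS]pf.
by rewrite -[in RHS]rf -horner_as_univariate.
Qed.

Lemma integral_variables : exists c,
  [/\ restr K B c = c, pi c != 0 & forall i, integralOver phi (pi (c * 'X_i))].
Proof.
suff: forall s : seq 'I_n, exists c, [/\ restr K B c = c, pi c != 0 &
    forall i, i \in s -> integralOver phi (pi (c * 'X_i))].
  move/(_ (enum 'I_n)) => [c [rc nzc intc]]; exists c; split=> // i.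
  by apply: intc; rewrite mem_enum.
elim=> [|i s [c [rc nzc intc]]]; first by exists 1; rewrite !rmorph1 oner_neq0.
have [d [rd nzd intd]] := integral_variable i.
have intr u : restr K B u = u -> integralOver phi (pi u).
  by move=> ru; rewrite -ru; apply: (integral_id phi).
exists (c * d); split; first by rewrite rmorphM /= rc rd.
  by rewrite rmorphM mulf_neq0.
move=> j; rewrite inE => /predU1P[->|js].
  by rewrite -mulrA rmorphM; apply: integral_mul => //; apply: intr.
by rewrite mulrAC rmorphM; apply: integral_mul; [apply: intc | apply: intr].
Qed.

(** Every monomial of [f] has degree below [msize f], so this power of a common denominator of the
    variables clears all of them. *)
Lemma integral_multiple f : exists c,
  [/\ restr K B c = c, pi c != 0 & integralOver phi (pi (c * f))].
Proof.
have [c [rc nzc intc]] := integral_variables.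
exists (c ^+ msize f); split; first by rewrite rmorphXn /= rc.
  by rewrite rmorphXn expf_neq0.
have intr u : restr K B u = u -> integralOver phi (pi u).
  by move=> ru; rewrite -ru; apply: (integral_id phi).
rewrite {2}(mpolyE f) mulr_sumr rmorph_sum big_seq.
apply: (big_ind (integralOver phi)) => [|u v|m mf]; [exact: integral0|exact: integral_add|].
have -> : c ^+ msize f * (f@_m *: 'X_[m]) =
    (c ^+ (msize f - mdeg m) * (f@_m)%:MP) * \prod_i (c * 'X_i) ^+ m i.
  rewrite (eq_bigr (fun i => c ^+ m i * 'X_i ^+ m i)) => [|i _]; last by rewrite exprMn.
  rewrite big_split prodrXr -mdegE -mpolyXE_id /= -mul_mpolyC.
  rewrite -{1}(subnK (ltnW (msize_mdeg_lt mf))) exprD -!mulrA; congr (_ * _).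
  by rewrite mulrCA.
rewrite rmorphM; apply: integral_mul.
  by apply: intr; rewrite rmorphM rmorphXn /= rc restr_C.
rewrite rmorph_prod; apply: (big_ind (integralOver phi)) => [|u v|i _]; [exact: integral1|exact: integral_mul|].
rewrite rmorphXn; elim: (m i) => [|k IHk]; first exact: integral1.
by rewrite exprS; apply: integral_mul.
Qed.

End Algebraic.

(** If no variable could be added, [B] would be maximal modulo [q]. Some multiple c g of an element
    g of [q'] outside [q] would then be integral over K[x_B] modulo [q], and the nonzero constant
    term of its equation would lie in both [q'] and K[x_B]. *)
Lemma independent_extend q q' B : is_prime_ideal q -> is_prime_ideal q' ->
  sub_ideal q q' -> ~ sub_ideal q' q -> independent B q' ->
  exists2 i, i \notin B & independent (i |: B) q.
Proof.
move=> qP q'P sqq' nsub indB.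
apply: NNPP => nex; have [E [pi piP]] := prime_ideal_kernel qP.
have indBq : independent B (fun f => pi f = 0).
  by apply: independent_sub indB => f /piP /sqq'.
have depB i : i \notin B -> ~ independent (i |: B) (fun f => pi f = 0).
  move=> iB ind; apply: nex; exists i => //.
  by apply: independent_sub ind => f /piP.
have [g q'g nqg] : exists2 g, q' g & ~ q g.
  by apply: NNPP => no; apply: nsub => g q'g; apply: NNPP => nqg; apply: no; exists g.
have [c [rc nzc intc]] := integral_multiple indBq depB g.
have [[_ q'D q'M] _ _] := q'P.
have nzcg : pi (c * g) != 0.
  rewrite rmorphM mulf_neq0 //; apply/eqP => /piP; exact: nqg.
have [Q [d [rootQ nzd]]] := integral_const_coef nzcg intc.
(* The equation holds modulo [q], hence modulo [q'], and its nonconstant terms are multiples of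
   [g]. *)
have : q' (restr K B d).
  have -> : restr K B d = ((map_poly (restr K B) Q).[c * g] * (c * g) + restr K B d)
               + (- (map_poly (restr K B) Q).[c * g] * c) * g.
    by rewrite mulrA mulNr mulNr addrAC addrN add0r.
  apply: q'D; last exact: q'M.
  apply: sqq'; apply/piP; rewrite rmorphD rmorphM -horner_map /= -map_poly_comp.
  exact: rootQ.
move/(indB _ (@supported_restr _ _ _ _)) => d0.
by move/eqP: nzd; apply; rewrite /= d0 rmorph0.
Qed.

(** Going down the chain, each strict inclusion adds an independent variable, and there are only [n]
    variables. *)
Lemma prime_chain_le p B m : independent B p -> prime_chain p m -> (#|B| + m <= n)%N.
Proof.
move=> indB [c [cP cS cE]].
have: forall k, (k <= m)%N -> exists2 A, independent A (c (m - k)%N) & #|A| = (#|B| + k)%N.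
  elim=> [_|k IHk lekm].
    by exists B; rewrite ?addn0 // subn0; apply: independent_sub indB => f /cE.
  have [A indA cardA] := IHk (ltnW lekm).
  have lt : (m - k.+1 < m)%N by rewrite ltn_subrL (leq_ltn_trans _ lekm).
  have mk : (m - k)%N = (m - k.+1).+1 by rewrite subnSK.
  rewrite mk in indA.
  have [i iA indiA] := independent_extend (cP _ (ltnW lt)) (cP _ lt) (cS _ lt).1 (cS _ lt).2 indA.
  by exists (i |: A) => //; rewrite cardsU1 iA cardA addnS.
move/(_ m (leqnn m)) => [A _ <-]; rewrite -[X in (_ <= X)%N]card_ord; exact: max_card.
Qed.

End Step.

(** * Counting monomials modulo binomials *)

Section Pigeonhole.
Variables (n h : nat) (K : fieldType) (p : {mpoly K[n]} -> Prop).
Variables (a b c d : 'I_h -> 'I_n) (w : 'I_n -> nat).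
Hypothesis pP : is_prime_ideal p.
Hypothesis bin_p : forall i, p ('X_(a i) * 'X_(b i) - 'X_(c i) * 'X_(d i)).
Hypotheses (injA : injective a) (injB : injective b) (disjAB : forall i j, a i != b j).
Hypothesis w_lt : forall i, (w (c i) + w (d i) < w (a i) + w (b i))%N.

Definition weight (m : 'X_{1..n}) : nat := (\sum_i m i * w i)%N.

Lemma weightD m1 m2 : weight (m1 + m2) = (weight m1 + weight m2)%N.
Proof. by rewrite /weight -big_split; apply: eq_bigr => i _; rewrite mnmDE mulnDl. Qed.

Lemma weight1 i : weight U_(i) = w i.
Proof.
rewrite /weight (bigD1 i) //= mnm1E eqxx mul1n big1 ?addn0 // => j ne.
by rewrite mnm1E eq_sym (negPf ne).
Qed.

Definition standard (m : 'X_{1..n}) := [forall i, (m (a i) == 0%N) || (m (b i) == 0%N)].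

(** Replacing a leading pair by its trailing pair preserves the degree and the class modulo [p] and
    lowers the weight, so the rewriting stops. *)
Lemma standard_monomial m : exists s, [/\ standard s, mdeg s = mdeg m & p ('X_[m] - 'X_[s])].
Proof.
have [[p0 pD pM] _ _] := pP.
have [k] := ubnP (weight m); elim: k m => // k IHk m; rewrite ltnS => lemk.
have [stm|] := boolP (standard m); first by exists m; rewrite subrr.
rewrite negb_forall => /existsP[i]; rewrite negb_or => /andP[ma mb].
have lem : (U_(a i) + U_(b i) <= m)%MM.
  apply/mnm_lepP => j; rewrite mnmDE !mnm1E.
  have [<-|_] := eqVneq (a i) j; last by case: eqVneq => // <-; rewrite lt0n.
  by rewrite eq_sym (negPf (disjAB i i)) addn0 lt0n.
pose m0 := (m - (U_(a i) + U_(b i)))%MM.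
have mE : m = (m0 + (U_(a i) + U_(b i)))%MM by rewrite submK.
have [|s [sts degs ps]] := IHk (m0 + (U_(c i) + U_(d i)))%MM.
  apply: leq_trans lemk; rewrite mE !weightD !weight1 ltn_add2l; exact: w_lt.
exists s; split=> //; first by rewrite degs mE !mdegD !mdeg1.
have -> : 'X_[m] - 'X_[s] = 'X_[m0] * ('X_(a i) * 'X_(b i) - 'X_(c i) * 'X_(d i)) +
     ('X_[m0 + (U_(c i) + U_(d i))] - 'X_[s]) :> {mpoly K[n]}.
  by rewrite mulrBr -!mpolyXD -mE addrA subrK.
by apply: pD => //; apply: pM.
Qed.

Definition freeT := {v : 'I_n | v \notin codom b}.

Lemma card_freeT : #|{: freeT}| = (n - h)%N.
Proof.
rewrite card_sig; transitivity #|predC (mem (codom b))|; first exact: eq_card.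
have E : (#|codom b| + #|predC (mem (codom b))|)%N = #|'I_n| by apply: cardC.
by move: E; rewrite card_codom // !card_ord => /(canRL (addKn h)) ->.
Qed.

(** The exponent at [b i] is added to the one at [a i], so that only the n - h variables outside the
    image of [b] need recording. *)
Definition code_val (s : 'X_{1..n}) v := (s v + \sum_(i | a i == v) s (b i))%N.

Lemma code_val_a s i : code_val s (a i) = (s (a i) + s (b i))%N.
Proof. by rewrite /code_val (big_pred1 i) // => j; rewrite (inj_eq injA). Qed.

Lemma code_val_out s v : v \notin codom a -> code_val s v = s v.
Proof.
move=> va; rewrite /code_val big_pred0 ?addn0 // => i.
by apply: contraNF va => /eqP <-; apply: codom_f.
Qed.

Lemma code_val_le s v : (code_val s v <= mdeg s)%N.
Proof.
rewrite mdegE; have [/codomP[i ->]|va] := boolP (v \in codom a).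
  rewrite code_val_a (bigD1 (a i)) //= leq_add2l (bigD1 (b i)) ?leq_addr //=.
  by rewrite eq_sym disjAB.
by rewrite code_val_out // (bigD1 v) //= leq_addr.
Qed.

(** In a standard monomial one of the exponents at [a i] and [b i] vanishes, so their sum and the
    bit telling whether the first is zero recover both. *)
Lemma code_inj s s' : standard s -> standard s' ->
  (forall i, (s (a i) == 0%N) = (s' (a i) == 0%N)) ->
  (forall v, v \notin codom b -> code_val s v = code_val s' v) -> s = s'.
Proof.
move=> /forallP st /forallP st' eqz eqv.
have ab i : s (a i) = s' (a i) /\ s (b i) = s' (b i).
  have := eqv (a i); rewrite !code_val_a => /(_ _) E.
  have {}E : (s (a i) + s (b i) = s' (a i) + s' (b i))%N.
    by apply: E; apply/negP => /codomP[j /eqP]; apply/negP/disjAB.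
  move: (st i) (st' i) (eqz i) E.
  by lia.
apply/mnmP => v; have [/codomP[i ->]|vb] := boolP (v \in codom b); first by case: (ab i).
have [/codomP[i ->]|va] := boolP (v \in codom a); first by case: (ab i).
by rewrite -!(code_val_out _ va) eqv.
Qed.

(** Monomials in x_B are pairwise incongruent modulo [p], yet each is congruent to a standard one of
    the same degree. For large exponent bounds there are too few codes of standard monomials if [B]
    has more than n - h elements. *)
Lemma independent_card B : independent B p -> (#|B| + h <= n)%N.
Proof.
move=> indB; rewrite leqNgt; apply/negP => ltn.
have h_le : (h <= n)%N by have := leq_card a injA; rewrite !card_ord.
have n_gt0 : (0 < n)%N.
  have : (#|B| <= n)%N by rewrite -[X in (_ <= X)%N]card_ord max_card.
  lia.
(* With exponents at most k, degrees are at most D = k n. The value of k ensures 2^h (n (k + 1))^(n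
   - h) < (k + 1)^(n - h + 1). *)
pose k := (2 ^ h * n ^ n)%N; pose D := (k * n)%N.
pose T := {ffun {v | v \in B} -> 'I_k.+1}.
pose mon (t : T) : 'X_{1..n} := [multinom (if insub i is Some v then t v else 0 : nat) | i < n].
have mon_deg t : (mdeg (mon t) <= D)%N.
  have -> : D = (\sum_(i < n) k)%N by rewrite sum_nat_const card_ord mulnC.
  rewrite mdegE; apply: leq_sum => i _.
  by rewrite mnmE; case: insub => // v; rewrite -ltnS.
have mon_inj t1 t2 : mon t1 = mon t2 -> t1 = t2.
  move=> /(congr1 (fun m : 'X_{1..n} => m _)) E; apply/ffunP => v; apply: val_inj.
  by have := E (val v); rewrite !mnmE valK.
have mon_sup t m : m \in msupp ('X_[mon t] : {mpoly K[n]}) -> forall i, i \notin B -> m i = 0%N.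
  by rewrite msuppX inE => /eqP -> i iB; rewrite mnmE insubN.
have /(_ _)/constructive_indefinite_description nf t := standard_monomial (mon t).
pose s t := proj1_sig (nf t).
have sP t : [/\ standard (s t), mdeg (s t) = mdeg (mon t) & p ('X_[mon t] - 'X_[s t])].
  exact: (proj2_sig (nf t)).
pose code t : {ffun 'I_h -> bool} * {ffun freeT -> 'I_D.+1} :=
  ([ffun i => s t (a i) == 0%N], [ffun v => inord (code_val (s t) (val v))]).
have code_injective : injective code.
  move=> t1 t2 [/ffunP e1 /ffunP e2].
  have [st1 d1 p1] := sP t1; have [st2 d2 p2] := sP t2.
  have es : s t1 = s t2.
    apply: code_inj => // [i|v vb]; first by have := e1 i; rewrite !ffunE.
    have := e2 (Sub v vb); rewrite !ffunE /= => /(congr1 val) /=.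
    by rewrite !inordK // ltnS (leq_trans (code_val_le _ _)) ?d1 ?d2.
  apply: mon_inj; have [[_ pD pM] _ _] := pP.
  (* Two monomials with the same standard form differ by an element of [p] in K[x_B], which is 0 by
     independence. *)
  have : p ('X_[mon t1] - 'X_[mon t2]).
    have -> : 'X_[mon t1] - 'X_[mon t2] =
       ('X_[mon t1] - 'X_[s t1]) + (-1) * ('X_[mon t2] - 'X_[s t2]) :> {mpoly K[n]}.
      by rewrite es mulN1r opprB addrA subrK.
    by apply: pD => //; apply: pM.
  move/indB => /(_ _)/eqP; rewrite subr_eq0 => E.
  have /eqP : 'X_[mon t1] == 'X_[mon t2] :> {mpoly K[n]}.
    by apply: E => m /msuppB_le; rewrite mem_cat => /orP[]; apply: mon_sup.
  move/(congr1 (mcoeff (mon t1))); rewrite !mcoeffX eqxx; case: eqP => //= _ /eqP.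
  by rewrite oner_eq0.
have := leq_card code code_injective.
rewrite card_prod !card_ffun card_freeT card_bool !card_ord card_sig.
have -> : #|[pred x | x \in B]| = #|B| by apply: eq_card.
apply/negP; rewrite -ltnNge.
have kn : (D.+1 <= n * k.+1)%N by rewrite /D; nia.
apply: (@leq_ltn_trans (2 ^ h * (n * k.+1) ^ (n - h))); first by
  rewrite leq_mul2l; case: (n - h)%N => [|e]; rewrite ?expn0 ?leq_exp2r ?kn ?orbT.
apply: (@leq_trans (k.+1 ^ (n - h).+1)); last by rewrite leq_pexp2l //; lia.
rewrite expnS expnMn mulnA ltn_pmul2r ?expn_gt0 // ltnS leq_mul2l.
by rewrite leq_pexp2l ?orbT // leq_subr.
Qed.

End Pigeonhole.

(** * Parity of crossings in the plane grid *)

(** Adjacency across a side, written in coordinates so that linear arithmetic can decide it. *)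
Definition zadj (A B : int * int) : bool :=
  ((A.1 == B.1) && ((B.2 == A.2 + 1) || (A.2 == B.2 + 1))) ||
  ((A.2 == B.2) && ((B.1 == A.1 + 1) || (A.1 == B.1 + 1))).

Lemma zadj_sym A B : zadj A B = zadj B A.
Proof. by rewrite /zadj; lia. Qed.

Lemma mem_cell_vertices_int (a v : int * int) : (v \in cell_vertices a) =
  ((v.1 == a.1) || (v.1 == a.1 + 1)) && ((v.2 == a.2) || (v.2 == a.2 + 1)).
Proof.
case: a v => [a1 a2] [v1 v2]; rewrite !inE /= !xpair_eqE /=.
by rewrite !addr0; do 4!case: (_ == _).
Qed.

Lemma mem_cell_vertices_nat (a v : nat * nat) : (v \in cell_vertices a) =
  (((v.1 == a.1) || (v.1 == a.1 + 1)) && ((v.2 == a.2) || (v.2 == a.2 + 1)))%N.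
Proof.
case: a v => [a1 a2] [v1 v2]; rewrite !inE /= !xpair_eqE /=.
by rewrite -![(_ + _)%R]/(_ + _)%N !addn0; do 4!case: (_ == _).
Qed.

Lemma fsetI_eq2 (T : choiceType) (U V : {fset T}) (u w t : T) :
  (U `&` V == [fset u; w])%fset -> t \in U -> t != u -> t != w ->
  [&& u \in V, w \in V & t \notin V].
Proof.
move=> /eqP/fsetP E tU tu tw; have := (E u, E w, E t).
rewrite !inE !eqxx (negPf tu) (negPf tw) tU orbT /= => -[[]].
by move=> /andP[_ ->] /andP[_ ->] ->.
Qed.

Lemma share_edge_zadj (A B : int * int) : share_edge A B -> zadj A B.
Proof.
case: A B => [a1 a2] [b1 b2]; rewrite /share_edge inE => /predU1P[/eqP|]; last first.
  rewrite !inE; case/or3P;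
  [move/(@fsetI_eq2 _ _ _ _ _ (a1 + 1, a2 + 1))
  | move/(@fsetI_eq2 _ _ _ _ _ (a1, a2)) | move/(@fsetI_eq2 _ _ _ _ _ (a1, a2))];
  rewrite !mem_cell_vertices_int !xpair_eqE /zadj /=; lia.
move/(@fsetI_eq2 _ _ _ _ _ (a1, a2 + 1)).
rewrite !mem_cell_vertices_int !xpair_eqE /zadj /=; lia.
Qed.

Definition zcell (A : nat * nat) : int * int := (A.1%:Z, A.2%:Z).

Lemma zcell_inj : injective zcell.
Proof. by move=> [a1 a2] [b1 b2] [-> ->]. Qed.

Definition nadj A B := zadj (zcell A) (zcell B).

Lemma share_edge_nadj (A B : nat * nat) : share_edge A B -> nadj A B.
Proof.
case: A B => [a1 a2] [b1 b2]; rewrite /share_edge !inE /nadj /zadj /=.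
case/or4P;
  [move/(@fsetI_eq2 _ _ _ _ _ (a1, a2 + 1)%N) | move/(@fsetI_eq2 _ _ _ _ _ (a1 + 1, a2 + 1)%N)
  | move/(@fsetI_eq2 _ _ _ _ _ (a1, a2)) | move/(@fsetI_eq2 _ _ _ _ _ (a1, a2))];
  rewrite !mem_cell_vertices_nat !xpair_eqE /= -![(_ + _)%R]/(_ + _)%N; lia.
Qed.

(** Parity of the number of steps, in either direction, between [X] and [Y]; [(+)] is addition
    modulo 2. *)
Fixpoint crossings (X Y : int * int) A (s : seq (int * int)) : bool :=
  if s is B :: s' then
    (((A == X) && (B == Y)) || ((A == Y) && (B == X))) (+) crossings X Y B s'
  else false.

(** A cell is named by its lower left vertex: the horizontal line through [v] separates the rows v.2
    - 1 and v.2, and the columns to the left of [v] have index below v.1. *)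
Definition hits (v A B : int * int) : bool :=
  [&& A.1 == B.1, A.1 < v.1 &
   ((A.2 == v.2 - 1) && (B.2 == v.2)) || ((A.2 == v.2) && (B.2 == v.2 - 1))].

(* Parity of the crossings of the walk [A :: s] with the horizontal ray to the left of [v]. *)
Fixpoint ray (v : int * int) A (s : seq (int * int)) : bool :=
  if s is B :: s' then hits v A B (+) ray v B s' else false.

(** Moving the vertex one unit to the right lengthens the ray by the side between the cells (x, y -
    1) and (x, y). *)
Lemma ray_horizontal x y A s :
  ray (x + 1, y) A s = ray (x, y) A s (+) crossings (x, y - 1) (x, y) A s.
Proof.
elim: s A => //= -[b1 b2] s IHs [a1 a2]; rewrite {}IHs.
have -> : hits (x + 1, y) (a1, a2) (b1, b2) = hits (x, y) (a1, a2) (b1, b2)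
   (+) ((((a1, a2) == (x, y - 1)) && ((b1, b2) == (x, y)))
     || (((a1, a2) == (x, y)) && ((b1, b2) == (x, y - 1)))).
  rewrite /hits /= !xpair_eqE; have [<-|ne] := eqVneq a1 b1; last first.
    have: ~~ ((a1 == x) && (b1 == x)).
      by apply: contraNN ne => /andP[/eqP -> /eqP ->].
    by case: (a1 == x); case: (b1 == x); rewrite ?andbF.
  have -> : (a1 < x + 1) = (a1 < x) || (a1 == x) by lia.
  by case: (ltrgtP a1 x) => _ /=; case: (a2 == _); case: (a2 == _); case: (b2 == _); case: (b2 == _).
by rewrite -!addbA; congr (_ (+) _); rewrite addbCA.
Qed.

(** The two rays and the side between (x - 1, y) and (x, y) bound the half row of cells of row y
    left of x. A step crosses this boundary exactly when one of its two ends lies in the half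
    row. *)
Lemma hits_vertical x y A B : zadj A B ->
  hits (x, y + 1) A B (+) hits (x, y) A B =
  (((A == (x - 1, y)) && (B == (x, y))) || ((A == (x, y)) && (B == (x - 1, y))))
  (+) (((A.2 == y) && (A.1 < x)) (+) ((B.2 == y) && (B.1 < x))).
Proof.
case: A B => [a1 a2] [b1 b2]; rewrite /zadj /hits /= !xpair_eqE addrK.
case/orP => /andP[/eqP -> /orP[] /eqP ->].
- have -> : (b1 == x - 1) && (a2 == y) && ((b1 == x) && (a2 + 1 == y)) = false by lia.
  have -> : (b1 == x) && (a2 == y) && ((b1 == x - 1) && (a2 + 1 == y)) = false by lia.
  rewrite eqxx; case: (b1 < x) => /=; last by rewrite !andbF.
  have [->|] := eqVneq a2 y; lia.
- have -> : (b1 == x - 1) && (b2 + 1 == y) && ((b1 == x) && (b2 == y)) = false by lia.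
  have -> : (b1 == x) && (b2 + 1 == y) && ((b1 == x - 1) && (b2 == y)) = false by lia.
  rewrite eqxx; case: (b1 < x) => /=; last by rewrite !andbF.
  have [->|] := eqVneq b2 y; lia.
- case: (b2 == y); lia.
- case: (b2 == y); lia.
Qed.

(** A closed walk enters and leaves the half row [S] an even number of times in total. *)
Lemma ray_vertical x y A s : path zadj A s -> last A s = A ->
  ray (x, y + 1) A s = ray (x, y) A s (+) crossings (x - 1, y) (x, y) A s.
Proof.
move=> pA lA; pose S (C : int * int) := (C.2 == y) && (C.1 < x).
suff: ray (x, y + 1) A s (+) ray (x, y) A s = crossings (x - 1, y) (x, y) A s (+) (S A (+) S (last A s)).
  by rewrite lA addbb addbF => <-; rewrite addbC addbK.
elim: s A pA {lA} => [|B s IHs] A /=; first by rewrite addbb.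
case/andP => /(hits_vertical x y) h /IHs r.
rewrite addbACA h r -/(S A) -/(S B).
by case: (S A); case: (S B); case: (S _); case: crossings; case: (_ || _).
Qed.

Lemma crossings_sym X Y A s : crossings X Y A s = crossings Y X A s.
Proof. by elim: s A => //= B s IHs A; rewrite IHs orbC. Qed.

Lemma crossings_cat X Y A s1 s2 :
  crossings X Y A (s1 ++ s2) = crossings X Y A s1 (+) crossings X Y (last A s1) s2.
Proof. by elim: s1 A => //= B s1 IHs1 A; rewrite IHs1 addbA. Qed.

Lemma crossings_outside (Q : pred (int * int)) X Y A s :
  Q A -> all Q s -> ~~ Q X -> crossings X Y A s = false.
Proof.
move=> + + nQ; elim: s A => //= B s IHs A QA /andP[QB Qs].
rewrite IHs // addbF; apply/negP.
by case/orP => /andP[/eqP e1 /eqP e2]; move: nQ; rewrite -?e1 -?e2 ?QA ?QB.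
Qed.

(** The parity changes between neighbouring corners of [X] only if the walk crosses the side joining
    them. The lower left corner [X] is the reference. *)
Lemma ray_cell A s X v : path zadj A s -> last A s = A ->
  (forall Y, crossings X Y A s = false) -> v \in cell_vertices X -> ray v A s = ray X A s.
Proof.
case: X v => [x y] [v1 v2] pA lA cr; rewrite mem_cell_vertices_int /=.
have b := ray_horizontal x y A s; rewrite crossings_sym cr addbF in b.
have l := ray_vertical x y pA lA; rewrite crossings_sym cr addbF in l.
have t := ray_horizontal x (y + 1) A s; rewrite addrK cr addbF in t.
by case/andP => /orP[] /eqP -> /orP[] /eqP ->; rewrite ?t ?b ?l.
Qed.

Lemma zadj_vertex X Y : zadj X Y -> (X \in cell_vertices Y) || (Y \in cell_vertices X).
Proof. by rewrite !mem_cell_vertices_int /zadj; lia. Qed.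

(** Adjacent cells share two vertices, so one of these avoids [v]. *)
Lemma zadj_shared X Y v : zadj X Y ->
  exists u, [/\ u \in cell_vertices X, u \in cell_vertices Y & u != v].
Proof.
case: X Y v => [x1 x2] [y1 y2] [v1 v2]; rewrite /zadj /=.
case/orP => /andP[/eqP -> /orP[] /eqP ->].
- have [->|/eqP ne] := eqVneq v1 y1; [exists (y1 + 1, x2 + 1) | exists (y1, x2 + 1)];
    by rewrite !mem_cell_vertices_int !xpair_eqE /=; split; lia.
- have [->|/eqP ne] := eqVneq v1 y1; [exists (y1 + 1, y2 + 1) | exists (y1, y2 + 1)];
    by rewrite !mem_cell_vertices_int !xpair_eqE /=; split; lia.
- have [->|/eqP ne] := eqVneq v2 y2; [exists (x1 + 1, y2 + 1) | exists (x1 + 1, y2)];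
    by rewrite !mem_cell_vertices_int !xpair_eqE /=; split; lia.
- have [->|/eqP ne] := eqVneq v2 y2; [exists (y1 + 1, y2 + 1) | exists (y1 + 1, y2)];
    by rewrite !mem_cell_vertices_int !xpair_eqE /=; split; lia.
Qed.

Lemma subr1_eqF (z : int) : (z - 1 == z) = false.
Proof. by lia. Qed.

Lemma eq_subr1F (z : int) : (z == z - 1) = false.
Proof. by lia. Qed.

(** * Consequences of a connected complement *)

Section Simple.
Variable P : pred (int * int).

Definition walk_connected (Q : pred (int * int)) :=
  forall X Y, Q X -> Q Y -> exists s, [/\ path zadj X s, all Q s & last X s = Y].

Hypothesis connC : walk_connected (predC P).

(** The parity is constant on each cell outside [P] and, the complement being connected, the same on
    all of them. Without a two by two block every vertex lies on such a cell, so no side is crossed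
    an odd number of times. *)
Lemma no_cycle X Y A s :
  (forall x y, ~~ [&& P (x, y), P (x - 1, y), P (x, y - 1) & P (x - 1, y - 1)]) ->
  path zadj A s -> last A s = A -> P A -> all P s -> zadj X Y -> crossings X Y A s = false.
Proof.
move=> no22 pA lA PA Ps.
pose r v := ray v A s.
have rcell Z v : ~~ P Z -> v \in cell_vertices Z -> r v = r Z.
  by move=> nPZ; apply: ray_cell => // Z'; apply: crossings_outside Ps nPZ.
have rconst Z Z' : ~~ P Z -> ~~ P Z' -> r Z = r Z'.
  move=> nZ nZ'; have [t [pt nt <-]] := connC nZ nZ'.
  elim: t Z nZ pt nt => //= B t IHt Z nZ /andP[/zadj_vertex adj pt] /andP[nB nt].
  rewrite -(IHt B) //; case/orP: adj => [/(rcell _ _ nB)|/(rcell _ _ nZ)] //.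
have near v : exists2 Z, ~~ P Z & v \in cell_vertices Z.
  case: v => x y; have := no22 x y; rewrite !negb_and => /or4P[] nP.
  - by exists (x, y); rewrite // mem_cell_vertices_int /= !eqxx.
  - by exists (x - 1, y); rewrite // mem_cell_vertices_int /= subrK !eqxx orbT.
  - by exists (x, y - 1); rewrite // mem_cell_vertices_int /= subrK !eqxx orbT.
  - by exists (x - 1, y - 1); rewrite // mem_cell_vertices_int /= !subrK !eqxx !orbT.
have rall v v' : r v = r v'.
  have [Z nZ vZ] := near v; have [Z' nZ' vZ'] := near v'.
  by rewrite (rcell _ _ nZ vZ) (rcell _ _ nZ' vZ'); apply: rconst.
have h x y : crossings (x, y - 1) (x, y) A s = false.
  have := ray_horizontal x y A s; rewrite -/(r _) -/(r (x, y)) (rall _ (x, y)).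
  by case: crossings; case: (r _).
have v x y : crossings (x - 1, y) (x, y) A s = false.
  have := ray_vertical x y pA lA; rewrite -/(r _) -/(r (x, y)) (rall _ (x, y)).
  by case: crossings; case: (r _).
case: X Y => [x1 x2] [y1 y2]; rewrite /zadj /=.
case/orP => /andP[/eqP -> /orP[] /eqP ->].
- by rewrite -{1}(addrK 1 x2).
- by rewrite crossings_sym -{1}(addrK 1 y2).
- by rewrite -{1}(addrK 1 x1).
- by rewrite crossings_sym -{1}(addrK 1 y1).
Qed.

(** Otherwise a walk in [P] between the two cells is closed up through the missing cell [G]. The
    parities then show that [G] cannot be joined outside [P] to the other missing cell. *)
Lemma no_diagonal x y : walk_connected P -> P (x, y) -> P (x - 1, y - 1) ->
  P (x - 1, y) || P (x, y - 1).
Proof.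
move=> connP Pne Psw; apply/negPn/negP; rewrite negb_or => /andP[nw se].
have [t [pt Pt lt]] := connP _ _ Pne Psw.
pose A := (x, y); pose G := (x - 1, y); pose s := t ++ [:: G; A].
have pA : path zadj A s.
  by rewrite cat_path pt /= lt /zadj /= !subrK !eqxx !orbT.
have lA : last A s = A by rewrite last_cat.
pose r v := ray v A s.
have PG Z Z' : ~~ P Z -> crossings Z Z' A s = crossings Z Z' (x - 1, y - 1) [:: G; A].
  by move=> nZ; rewrite crossings_cat lt (crossings_outside _ _ Pt nZ).
have rcell Z v : ~~ P Z -> Z != G -> v \in cell_vertices Z -> r v = r Z.
  move=> nPZ ZG; apply: ray_cell => // Z'; rewrite PG //= addbF.
  have ZA : Z != A by apply: contraNneq nPZ => ->.
  have ZO : Z != (x - 1, y - 1) by apply: contraNneq nPZ => ->.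
  by rewrite ![_ == Z]eq_sym (negPf ZA) (negPf ZO) (negPf ZG) /= !andbF.
(* The walk crosses only the two sides of [G] meeting at (x, y), so this vertex is separated from
   the other three. The property [R] spreads from [G] through the complement. *)
pose R Z := forall u, u \in cell_vertices Z -> u != (x, y) -> r u = ~~ r (x, y).
have RG : R G.
  have OG : ((x - 1, y - 1) == G) = false by rewrite /G xpair_eqE subr1_eqF andbF.
  have AG : (A == G) = false by rewrite /A /G xpair_eqE eq_subr1F.
  have PGG Z : crossings G Z A s = ((x - 1, y - 1) == Z) (+) (A == Z).
    by rewrite PG //= OG AG eqxx /= !andbT andbF orbF addbF.
  have e1 : r (x - 1 + 1, y) = ~~ r (x - 1, y).
    rewrite /r ray_horizontal crossings_sym PGG eqxx.
    by rewrite /A xpair_eqE eq_subr1F addbF addbT.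
  have e2 : r (x, y + 1) = ~~ r (x, y).
    rewrite /r ray_vertical // PGG eqxx.
    by rewrite xpair_eqE subr1_eqF addFb addbT.
  have e3 : r (x - 1, y + 1) = r (x - 1, y).
    rewrite /r ray_vertical // crossings_sym PGG /A !xpair_eqE.
    have -> : (x == x - 1 - 1) = false by rewrite -addrA -subr_eq0 opprD addNKr.
    by rewrite eq_subr1F addbF.
  move=> [u1 u2]; rewrite subrK in e1; rewrite mem_cell_vertices_int /= subrK xpair_eqE.
  case/andP => /orP[] /eqP -> /orP[] /eqP -> => //; rewrite ?e2 ?e3 ?e1 ?negbK //.
  by rewrite !eqxx.
(* The parity is constant on [Z'] unless it is [G], and a vertex shared with [Z] other than (x, y)
   carries the value over. *)
have Rstep Z Z' : ~~ P Z -> ~~ P Z' -> zadj Z Z' -> R Z -> R Z'.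
  move=> nZ nZ' adj RZ; have [->//|Z'G] := eqVneq Z' G.
  have [u [uZ uZ' uv]] := zadj_shared (x, y) adj.
  by move=> v vZ' _; rewrite (rcell _ _ nZ' Z'G vZ') -(rcell _ _ nZ' Z'G uZ') RZ.
have Rse : R (x, y - 1).
  have walk_R u Z : ~~ P Z -> R Z -> path zadj Z u -> all (predC P) u -> R (last Z u).
    elim: u Z => [|B u IHu] Z nZ RZ; first by [].
    case/andP => adj pu /andP[nB nu]; apply: IHu => //; exact: Rstep RZ.
  have [t' [pt' nt' <-]] := connC nw se.
  exact: walk_R.
have neG : (x, y - 1) != G by rewrite /G xpair_eqE eq_subr1F.
(* The parity is also constant on this cell, which has (x, y) as a corner: a contradiction. *)
have := Rse (x, y - 1); rewrite mem_cell_vertices_int /= !eqxx xpair_eqE -subr_eq0 => /(_ isT).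
rewrite -(rcell (x, y - 1) (x, y)) // ?mem_cell_vertices_int /= ?subrK ?eqxx ?orbT //.
by case: (r _); lia.
Qed.

End Simple.

(** The reflection [m] exchanges the two diagonals and preserves connectedness. *)
Lemma no_antidiagonal P x y : walk_connected (predC P) -> walk_connected P ->
  P (x - 1, y) -> P (x, y - 1) -> P (x, y) || P (x - 1, y - 1).
Proof.
pose m (C : int * int) := (- C.1, C.2).
have mK : involutive m by case=> a b; rewrite /m opprK.
have mconn Q : walk_connected Q -> walk_connected (Q \o m).
  move=> connQ X Y /= QX QY; have [s [ps Qs ls]] := connQ _ _ QX QY.
  exists (map m s); split.
  - rewrite -[X]mK path_map; apply: sub_path ps => A B.
    by rewrite /zadj /m /=; lia.
  - by rewrite all_map (eq_all (a2 := Q)) // => A /=; rewrite mK.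
  - by rewrite -[X]mK last_map ls mK.
move=> cC cP Pnw Pse.
(* Column 1 - x is the mirror image of column x - 1, so the two given cells become diagonal
   neighbours. *)
have := @no_diagonal (P \o m) (mconn _ cC) (1 - x) y (mconn _ cP).
by rewrite /m /= opprB addrAC subrr add0r opprK orbC; apply.
Qed.

(** * Attaching the cells of a tree one by one *)

Lemma nadj_sym A B : nadj A B = nadj B A.
Proof. exact: zadj_sym. Qed.

Lemma nadj_irr C : nadj C C = false.
Proof. by rewrite /nadj /zadj; lia. Qed.

(* Newest cell first. *)
Inductive leaf_order : seq (nat * nat) -> Prop :=
| leaf_order1 C : leaf_order [:: C]
| leaf_order_cons s C D : leaf_order s -> C \notin s -> D \in s -> nadj C D ->
    (forall v F, v \in cell_vertices C -> v \notin cell_vertices D -> F \in s ->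
       v \notin cell_vertices F) ->
    leaf_order (C :: s).

Definition nwalk (Q : pred (nat * nat)) A B :=
  exists s, [/\ path nadj A s, all Q s & last A s = B].

Lemma nwalk_trans Q B A C : nwalk Q A B -> nwalk Q B C -> nwalk Q A C.
Proof.
move=> [s [ps Qs ls]] [t [pt Qt lt]]; exists (s ++ t).
by rewrite cat_path all_cat last_cat ls ps Qs.
Qed.

Lemma nwalk1 (Q : pred (nat * nat)) A B : nadj A B -> Q B -> nwalk Q A B.
Proof. by move=> adj QB; exists [:: B]; rewrite /= adj QB. Qed.

Lemma nwalk_sub (Q Q' : pred (nat * nat)) A B :
  (forall C, Q C -> Q' C) -> nwalk Q A B -> nwalk Q' A B.
Proof. by move=> sQ [s [ps Qs ls]]; exists s; split=> //; apply: sub_all Qs. Qed.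

Lemma leaf_order_walk s A B : leaf_order s -> A \in s -> B \in s -> nwalk (mem s) A B.
Proof.
move=> lo; elim: lo A B => [C|{}s C D lo IHlo Cs Ds adj new] A B.
  by rewrite !inE => /eqP -> /eqP ->; exists [::].
have sub E : E \in s -> E \in C :: s by rewrite inE orbC => ->.
have CC : C \in C :: s by rewrite inE eqxx.
rewrite !inE => /predU1P[->|As] /predU1P[->|Bs].
- by exists [::].
- apply: (@nwalk_trans _ D); first by apply: nwalk1 => //; apply: sub.
  by apply: nwalk_sub (IHlo _ _ Ds Bs).
- apply: (@nwalk_trans _ D); first by apply: nwalk_sub (IHlo _ _ As Ds).
  by apply: nwalk1; rewrite 1?nadj_sym.
- by apply: nwalk_sub (IHlo _ _ As Bs).
Qed.

Lemma nwalk_boundary Q (s : seq (nat * nat)) A B : nwalk Q A B -> A \in s -> B \notin s ->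
  exists D C, [/\ D \in s, C \notin s, Q C & nadj D C].
Proof.
move=> [t [pt Qt lt]]; elim: t A pt Qt lt => [|E t IHt] A /=; first by move=> _ _ -> ->.
case/andP => adj pt /andP[QE Qt] lt As Bs.
by have [Es|Es] := boolP (E \in s); [apply: IHt pt Qt lt Es Bs | exists A, E].
Qed.

Section Tree.
Variable P : {fset nat * nat}.
Hypothesis treeP : tree_polyomino P.

Let Pz : pred (int * int) := fun C => C \in cells_in_Z2 P.

Let Pz_zcell C : Pz (zcell C) = (C \in P).
Proof.
apply/imfsetP/idP => [[D /= DP]|CP]; last by exists C.
by move/(@zcell_inj C D) ->.
Qed.

Let PzP X : Pz X -> exists2 C, C \in P & X = zcell C.
Proof. by case/imfsetP => C /= CP ->; exists C. Qed.

Let conn : walk_connected Pz.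
Proof.
case: treeP => -[cP _] _ _ X Y /PzP[C CP ->] /PzP[D DP ->].
have [s [ps sP ls]] := cP _ _ CP DP; exists (map zcell s); split.
- by rewrite path_map; apply: sub_path ps => A B; apply: share_edge_nadj.
- by rewrite all_map; apply: sub_all sP => A /=; rewrite Pz_zcell.
- by rewrite last_map ls.
Qed.

Lemma tree_walk A B : A \in P -> B \in P -> nwalk (mem P) A B.
Proof.
case: treeP => -[cP _] _ _ AP BP; have [s [ps sP ls]] := cP _ _ AP BP; exists s; split=> //.
by apply: sub_path ps => C D; apply: share_edge_nadj.
Qed.

Let connC : walk_connected (predC Pz).
Proof.
case: treeP => -[_ cC] _ _ X Y XP YP.
have [s [ps sP ls]] := cC X Y XP YP; exists s; split=> //.
by apply: sub_path ps => A B; apply: share_edge_zadj.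
Qed.

Lemma tree_no22 x y : ~~ [&& (x, y) \in P, (x.+1, y) \in P, (x, y.+1) \in P & (x.+1, y.+1) \in P].
Proof.
apply/negP => /and4P[P00 P10 P01 P11]; case: treeP => _ _ /(_ (x, y)); apply; split.
  by rewrite /proper_interval /=; lia.
case=> c1 c2; rewrite /le2 /= => le1 le2.
have : (c1 == x) || (c1 == x.+1) by lia.
have : (c2 == y) || (c2 == y.+1) by lia.
by case/orP => /eqP -> /orP[] /eqP ->.
Qed.

Let no22 x y : ~~ [&& Pz (x, y), Pz (x - 1, y), Pz (x, y - 1) & Pz (x - 1, y - 1)].
Proof.
apply/negP => /and4P[P11 P01 P10 /PzP[[a b] P00 [ex ey]]].
have {}ex : x = a.+1 by lia.
have {}ey : y = b.+1 by lia.
have ea : x - 1 = a by lia.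
have eb : y - 1 = b by lia.
rewrite ea eb ex ey in P11 P01 P10.
have := tree_no22 a b; rewrite P00 -!Pz_zcell.
by rewrite P11 P01 P10.
Qed.

Lemma tree_no_cycle X Y A s : path nadj A s -> last A s = A -> A \in P -> all (mem P) s ->
  nadj X Y -> crossings (zcell X) (zcell Y) (zcell A) (map zcell s) = false.
Proof.
move=> ps ls AP sP adj; apply: (@no_cycle Pz) => //.
- by rewrite path_map.
- by rewrite last_map ls.
- by rewrite Pz_zcell.
- by rewrite all_map; apply: sub_all sP => C /=; rewrite Pz_zcell.
Qed.

Lemma tree_diagonal x y : (x, y) \in P -> (x.+1, y.+1) \in P ->
  ((x.+1, y) \in P) || ((x, y.+1) \in P).
Proof.
have B (n : nat) : n.+1%:Z - 1 = n by lia.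
have := @no_diagonal Pz connC x.+1 y.+1 conn; rewrite !B.
by rewrite -!Pz_zcell /zcell /= => h P00 P11; rewrite orbC; apply: h.
Qed.

Lemma tree_antidiagonal x y : (x.+1, y) \in P -> (x, y.+1) \in P ->
  ((x, y) \in P) || ((x.+1, y.+1) \in P).
Proof.
have B (n : nat) : n.+1%:Z - 1 = n by lia.
have := @no_antidiagonal Pz x.+1 y.+1 connC conn; rewrite !B.
by rewrite -!Pz_zcell /zcell /= => h P10 P01; rewrite orbC; apply: h.
Qed.

(** Cells meeting only at [v] are diagonal or antidiagonal neighbours, and then a third cell around
    [v] belongs to [P]. *)
Lemma tree_corner v C F : C \in P -> F \in P -> v \in cell_vertices C -> v \in cell_vertices F ->
  [\/ C = F, nadj C F | exists G, [/\ G \in P, nadj C G, nadj G F & v \in cell_vertices G]].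
Proof.
case: C F v => [c1 c2] [f1 f2] [v1 v2] CP FP; rewrite !mem_cell_vertices_nat /= => vC vF.
have [adj|nadjCF] := boolP (nadj (c1, c2) (f1, f2)); first by constructor 2.
have [->|ne] := eqVneq (c1, c2) (f1, f2); first by constructor 1.
constructor 3.
have diag : ((f1 == c1.+1) || (c1 == f1.+1)) && ((f2 == c2.+1) || (c2 == f2.+1)).
  by move: ne nadjCF; rewrite xpair_eqE /nadj /zadj /=; lia.
have goal a b (aP : Pz (a%:Z, b%:Z)) : ((v1 == a) || (v1 == a + 1))%N -> ((v2 == b) || (v2 == b + 1))%N ->
   nadj (c1, c2) (a, b) -> nadj (a, b) (f1, f2) -> exists G : nat * nat,
  [/\ G \in P, nadj (c1, c2) G, nadj G (f1, f2) & (v1, v2) \in cell_vertices G].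
  move=> h1 h2 h3 h4; exists (a, b); rewrite -Pz_zcell mem_cell_vertices_nat.
  by split=> //=; rewrite h1 h2.
have two : Pz (c1%:Z, f2%:Z) || Pz (f1%:Z, c2%:Z).
  rewrite (Pz_zcell (c1, f2)) (Pz_zcell (f1, c2)).
  case/andP: diag CP FP {vC vF ne nadjCF} => /orP[] /eqP -> /orP[] /eqP -> CP FP.
  - by rewrite orbC; apply: tree_diagonal.
  - by apply: tree_antidiagonal.
  - by rewrite orbC; apply: tree_antidiagonal.
  - by apply: tree_diagonal.
by case/orP: two => h; apply: (goal _ _ h); move: diag vC vF; rewrite /nadj /zadj /=; lia.
Qed.

(** Any cell [C] outside [s] adjacent to a cell [D] of [s] can be attached. If an older cell [F]
    contained a vertex of [C] off [D], a walk from [D] to [F] in [s], closed around that vertex,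
    would cross the side between [C] and [D] exactly once. *)
Lemma tree_leaf_step s : leaf_order s -> {subset s <= P} -> (exists2 X, X \in P & X \notin s) ->
  exists2 C, C \in P & leaf_order (C :: s).
Proof.
move=> lo sP [X XP Xs].
have [A As] : exists A, A \in s.
  by case: (lo) => [C|s' C]; exists C; rewrite inE eqxx.
have [D [C [Ds Cs CP adj]]] := nwalk_boundary (tree_walk (sP _ As) XP) As Xs.
have {}CP : C \in P by exact: CP.
have adj' : nadj C D by rewrite nadj_sym.
exists C => //; apply: (leaf_order_cons lo Cs Ds adj') => v F vC vD Fs.
apply/negP => vF; have [t [pt ts lt]] := leaf_order_walk lo Ds Fs.
have tP : all (mem P) t by apply: sub_all ts => E /sP.
have noC E u : C \notin E :: u -> crossings (zcell C) (zcell D) (zcell E) (map zcell u) = false.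
  elim: u E => //= B u IHu E; rewrite !inE !negb_or => /and3P[CE CB Cu].
  rewrite IHu ?inE ?negb_or ?CB // !(inj_eq zcell_inj) ![_ == C]eq_sym.
  by rewrite (negPf CE) (negPf CB) andbF.
have Ct : C \notin D :: t.
  by apply: contra Cs; rewrite inE => /predU1P[->//|]; apply: (allP ts).
have FD : F != D by apply: contraNneq vD => <-.
have CD : D != C by apply: contraNneq Cs => <-.
(* Here [w] leads from [F] back to [C] through cells around [v]; it is empty or a single cell [G]
   below. *)
have cyc w : path nadj F (rcons w C) -> all (mem P) w -> all (fun E => v \in cell_vertices E) w ->
    C \notin w -> False.
  move=> pw wP wv Cw.
  have pth : path nadj C (D :: t ++ rcons w C) by rewrite /= adj' cat_path pt lt pw.
  have lst : last C (D :: t ++ rcons w C) = C by rewrite /= last_cat last_rcons.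
  have al : all (mem P) (D :: t ++ rcons w C).
    rewrite -cats1 catA -cat_cons all_cat /= CP andbT.
    by rewrite all_cat tP wP /= sP.
  have := tree_no_cycle pth lst CP al adj'; rewrite /=.
  rewrite !eqxx map_cat crossings_cat noC // last_map lt map_rcons -cats1 crossings_cat noC; last first.
    by rewrite inE negb_or Cw andbT; apply: contraNneq Cs => ->.
  rewrite last_map /= !(inj_eq zcell_inj) eqxx andbT addbF orbC.
  (* The final step into [C] comes from a cell containing [v], hence not from [D], so it does not
     cross the side a second time. *)
  have wD : last F w != D.
    apply: contraNneq vD => <-.
    by have := mem_last F w; rewrite inE => /predU1P[->//|]; apply: (allP wv).
  by rewrite (negPf wD) [C == D]eq_sym (negPf CD) andbF.
have Fne : F != C by apply: contraNneq Cs => <-.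
have [eCF|adjCF|[G [GP CG GF vG]]] := tree_corner CP (sP _ Fs) vC vF.
- by rewrite eCF eqxx in Fne.
- by apply: (cyc [::]); rewrite //= nadj_sym adjCF.
- apply: (cyc [:: G]); rewrite /= ?GP ?vG //.
    by rewrite nadj_sym GF nadj_sym CG.
  by rewrite inE; apply: contraTneq CG => ->; rewrite nadj_irr.
Qed.

Lemma leaf_order_uniq s : leaf_order s -> uniq s.
Proof. by elim=> //= s' C D _ -> ->. Qed.

Lemma tree_leaf_order : exists2 s, leaf_order s & s =i P.
Proof.
have [C0 CP] : exists C, C \in P by case: treeP => _ [C /andP[CP _]] _; exists C.
suff: forall k, (k < #|` P|)%N -> exists s, [/\ leaf_order s, {subset s <= P} & size s = k.+1].
  have P0 : (#|` P|.-1 < #|` P|)%N by rewrite prednK // cardfs_gt0; apply/fset0Pn; exists C0.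
  case/(_ _ P0) => s [lo sP]; rewrite prednK ?(leq_ltn_trans _ P0) // => szs; exists s => //.
  have [] := uniq_min_size (leaf_order_uniq lo) (s2 := enum_fset P); rewrite ?szs //.
elim=> [_|k IHk ltk].
  by exists [:: C0]; split=> [|E|//]; [constructor | rewrite inE => /eqP ->].
have [s [lo sP szs]] := IHk (ltnW ltk).
have [] := @tree_leaf_step s lo sP.
  apply: NNPP => nex; suff : (#|` P| <= size s)%N by rewrite szs leqNgt ltk.
  apply: uniq_leq_size => [|X XP]; first exact: fset_uniq.
  by apply/negPn/negP => Xs; apply: nex; exists X.
move=> C CP' lo'; exists (C :: s); split=> //; last by rewrite /= szs.
by move=> E; rewrite inE => /predU1P[->//|/sP].
Qed.

End Tree.

(** * Functions with prescribed curvature *)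

Section Curvature.
Implicit Types (w : nat * nat -> int) (C v : nat * nat).

Definition curv w C : int :=
  w C + w (C.1.+1, C.2.+1) - w (C.1.+1, C.2) - w (C.1, C.2.+1).

Definition upd w v t : nat * nat -> int := fun u => if u == v then t else w u.

Lemma cell_corners C : [/\ C \in cell_vertices C, (C.1.+1, C.2.+1) \in cell_vertices C,
  (C.1.+1, C.2) \in cell_vertices C & (C.1, C.2.+1) \in cell_vertices C].
Proof. by rewrite !mem_cell_vertices_nat /= !addn1 !eqxx !orbT. Qed.

Lemma upd_out w v t u : u != v -> upd w v t u = w u.
Proof. by rewrite /upd => /negPf ->. Qed.

Lemma curv_upd_out w v t C : v \notin cell_vertices C -> curv (upd w v t) C = curv w C.
Proof.
have [c1 c2 c3 c4] := cell_corners C.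
move=> vC; have out u : u \in cell_vertices C -> u != v by apply: contraTneq => ->.
by rewrite /curv !upd_out ?out.
Qed.

(** Every corner enters [curv] with coefficient 1 or -1, so the equation can be solved at any one of
    them. *)
Lemma curv_solve w v C (x : int) : v \in cell_vertices C -> exists t, curv (upd w v t) C = x.
Proof.
case: C v => [c1 c2] [v1 v2]; rewrite mem_cell_vertices_nat /= !addn1 /curv /upd /=.
have n k : (k == k.+1) = false by lia.
have n' k : (k.+1 == k) = false by lia.
case/andP => /orP[] /eqP -> /orP[] /eqP ->; rewrite !xpair_eqE ?eqxx ?n ?n' /=.
- by exists (x + w (c1, c2.+1) + w (c1.+1, c2) - w (c1.+1, c2.+1)); lia.
- by exists (w (c1, c2) + w (c1.+1, c2.+1) - w (c1.+1, c2) - x); lia.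
- by exists (w (c1, c2) + w (c1.+1, c2.+1) - w (c1, c2.+1) - x); lia.
- by exists (x + w (c1, c2.+1) + w (c1.+1, c2) - w (c1, c2)); lia.
Qed.

(** The sum telescopes in both directions, leaving only the corners of the interval. *)
Lemma curv_sum w a1 b1 a2 b2 : (a1 <= b1)%N -> (a2 <= b2)%N ->
  \sum_(a1 <= i < b1) \sum_(a2 <= j < b2) curv w (i, j) =
  w (a1, a2) + w (b1, b2) - w (b1, a2) - w (a1, b2).
Proof.
move=> le1 le2; pose f i := w (i, b2) - w (i, a2).
rewrite (telescope_sumr_eq f) // => [|i _]; first by rewrite /f; lia.
pose g j := w (i.+1, j) - w (i, j).
by rewrite (telescope_sumr_eq g) // => [|j _]; rewrite /f /g /curv /=; lia.
Qed.

End Curvature.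

(** The vertices [u] and [v] are the ends of the side of [C] opposite to [D]. *)
Lemma nadj_new C D : nadj C D -> exists u v,
  [/\ [&& u \in cell_vertices C, v \in cell_vertices C, u != v,
          u \notin cell_vertices D & v \notin cell_vertices D] &
   forall z, z \in cell_vertices C -> z \notin cell_vertices D -> (z == u) || (z == v)].
Proof.
case: C D => [c1 c2] [d1 d2]; rewrite /nadj /zadj /= => adj.
have : [|| (d1 == c1) && (d2 == c2.+1), (d1 == c1) && (c2 == d2.+1),
    (d2 == c2) && (d1 == c1.+1) | (d2 == c2) && (c1 == d1.+1)] by lia.
case/or4P => /andP[/eqP -> /eqP ->] {adj};
  [exists (c1, c2), (c1.+1, c2) | exists (c1, d2.+2), (c1.+1, d2.+2)
  | exists (c1, c2), (c1, c2.+1) | exists (d1.+2, c2), (d1.+2, c2.+1)];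
  by (split; [|case=> z1 z2]; rewrite !mem_cell_vertices_nat !xpair_eqE /=; lia).
Qed.

(* Each attached cell brings one vertex to [B] and one to [N]. *)
Lemma curv_extension s : leaf_order s -> exists B N : seq (nat * nat),
  [/\ uniq (B ++ N), size N = size s,
     forall v, (v \in B ++ N) = has (fun C => v \in cell_vertices C) s &
     forall beta delta, exists w : nat * nat -> int,
      (forall v, v \in B -> w v = beta v) /\ (forall C, C \in s -> curv w C = delta C)].
Proof.
elim=> [C|{}s C D lo [B [N [uBN sN memBN ext]]] Cs Ds adj new].
  case: C => c1 c2; exists [:: (c1, c2); (c1.+1, c2); (c1, c2.+1)], [:: (c1.+1, c2.+1)]; split=> //.
  - rewrite /= !inE !xpair_eqE; lia.
  - case=> v1 v2; rewrite /= orbF mem_cell_vertices_nat !inE !xpair_eqE /=; lia.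
  - move=> beta delta.
    have [|t E] := @curv_solve beta (c1.+1, c2.+1) (c1, c2) (delta (c1, c2)).
      by have [] := cell_corners (c1, c2).
    exists (upd beta (c1.+1, c2.+1) t); split=> [v|C].
      rewrite !inE => /or3P[] /eqP ->; rewrite upd_out // xpair_eqE; lia.
    by rewrite inE => /eqP ->.
have [u [v [/and5P[uC vC uv uD vD] only]]] := nadj_new adj.
have out z : z \in cell_vertices C -> z \notin cell_vertices D -> z \notin B ++ N.
  by move=> zC zD; rewrite memBN; apply/hasPn => F Fs; apply: new zC zD Fs.
have uBN' := out _ uC uD; have vBN := out _ vC vD.
exists (u :: B), (v :: N); split.
- rewrite cat_cons cons_uniq uniq_catC cat_cons cons_uniq [uniq (N ++ B)]uniq_catC uBN andbT.
  move: uBN' vBN; rewrite !mem_cat !inE (negPf uv) !negb_or => /andP[-> ->] /andP[-> ->] //.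
- by rewrite /= sN.
- move=> z; transitivity [|| z == u, z == v | z \in B ++ N].
    by rewrite /= !inE !mem_cat !inE; congr (_ || _); rewrite orbCA.
  rewrite memBN /=; apply/idP/idP => [/or3P[/eqP ->|/eqP ->|->]|/orP[zC|->]]; rewrite ?uC ?vC ?orbT //.
  have [zD|zD] := boolP (z \in cell_vertices D).
    by rewrite (introT hasP) ?orbT //; exists D.
  by case/orP: (only z zC zD) => ->; rewrite ?orbT.
- move=> beta delta; have [w [wB wC]] := ext beta delta.
  (* The vertex [u] gets its prescribed value and [v] is solved for. Neither lies on an older cell,
     so earlier curvatures are unchanged. *)
  have [t E] := @curv_solve (upd w u (beta u)) v C (delta C) vC.
  exists (upd (upd w u (beta u)) v t); split=> [z|F].
    have Bne x z' : x \notin B ++ N -> z' \in B -> z' != x.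
      by move=> xBN z'B; apply: contraNneq xBN => <-; rewrite mem_cat z'B.
    rewrite inE => /predU1P[->|zB]; first by rewrite upd_out // /upd eqxx.
    by rewrite !upd_out ?wB // (Bne _ _ _ zB).
  rewrite inE => /predU1P[-> //|Fs]; rewrite !curv_upd_out ?wC //.
    exact: new uC uD Fs.
  exact: new vC vD Fs.
Qed.

(** * Maximal strips *)

Lemma nadj_corner C F D : nadj C F -> nadj C D -> F != D ->
  exists v, [/\ v \in cell_vertices C, v \in cell_vertices F & v \notin cell_vertices D].
Proof.
case: C F D => [c1 c2] [f1 f2] [d1 d2] adjF adjD; rewrite xpair_eqE => ne.
(* In the coordinate along the side common to [C] and [F], choose the end away from [D]; in the
   other coordinate the maximum locates that side. *)
exists (if f1 == c1 then (if d1 == c1.+1 then c1 else c1.+1) else maxn c1 f1,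
        if f2 == c2 then (if d2 == c2.+1 then c2 else c2.+1) else maxn c2 f2).
rewrite !mem_cell_vertices_nat /=; move: adjF adjD ne; rewrite /nadj /zadj /=.
by case: (f1 == c1) / eqP => ?; case: (f2 == c2) / eqP => ?;
  case: (d1 == c1.+1) / eqP => ?; case: (d2 == c2.+1) / eqP => ?; split; lia.
Qed.

(** A larger index means an older cell. When [E] was attached, a second older neighbour besides its
    parent would have shared with [E] a vertex off the parent. *)
Lemma leaf_order_older s E F G : leaf_order s -> F \in s -> G \in s -> nadj E F -> nadj E G ->
  (index E s < index F s)%N -> (index E s < index G s)%N -> F = G.
Proof.
elim=> [C|{}s C D lo IHlo Cs Ds adj new].
  by rewrite !inE => /eqP -> /eqP ->.
have [->|CE] := eqVneq E C.
  have eqD H : H \in C :: s -> nadj C H -> (index C (C :: s) < index H (C :: s))%N -> H = D.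
    rewrite inE => /predU1P[->|Hs]; first by rewrite ltnn.
    move=> adjH _; apply/eqP; apply: contraT => ne.
    have [v [vC vH vD]] := nadj_corner adjH adj ne.
    by have := new v H vC vD Hs; rewrite vH.
  by move=> Fs Gs aF aG iF iG; rewrite (eqD F) // (eqD G).
rewrite !inE /= [C == E]eq_sym (negPf CE).
case: (eqVneq C F) => [_|_]; first by rewrite ltn0.
case: (eqVneq C G) => [_|_]; first by rewrite ltn0.
rewrite !ltnS /=; exact: IHlo.
Qed.

(* The cells at position [t] of the vertical ([o = true]) or horizontal line number [f]. *)
Definition line (o : bool) (f t : nat) : nat * nat := if o then (f, t) else (t, f).

Lemma line_inj o f : injective (line o f).
Proof. by case: o => t t' []. Qed.

Lemma nadj_line o f t : nadj (line o f t) (line o f t.+1).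
Proof. by case: o; rewrite /nadj /zadj /=; lia. Qed.

(** The bound [hi] is exclusive, and thus also the coordinate of the far end of the strip. *)
Record strip := Strip { vert : bool; pos : nat; lo : nat; hi : nat }.

Definition strip_cell S t := line (vert S) (pos S) t.

(** The last condition is vacuous when [lo S] is 0, which avoids a truncated predecessor. *)
Definition maximal_strip (s : seq (nat * nat)) S :=
  [/\ (lo S < hi S)%N, forall t, (lo S <= t < hi S)%N -> strip_cell S t \in s,
      strip_cell S (hi S) \notin s & forall t, t.+1 = lo S -> strip_cell S t \notin s].

Lemma maximal_strip_exists s o f t0 : line o f t0 \in s ->
  exists S, [/\ maximal_strip s S, vert S = o, pos S = f & (lo S <= t0 < hi S)%N].
Proof.
move=> t0s.
(* Otherwise [s] would contain [size s] + 1 distinct cells of the line. *)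
have exh : exists h, (t0 < h)%N && (line o f h \notin s).
  apply: NNPP => nex.
  have sub : {subset map (line o f) (iota t0.+1 (size s).+1) <= s}.
    move=> _ /mapP[t + ->]; rewrite mem_iota => /andP[lt _].
    by apply/negPn/negP => ns; apply: nex; exists t; rewrite lt.
  have := uniq_leq_size _ sub; rewrite map_inj_uniq ?iota_uniq; last exact: line_inj.
  by rewrite size_map size_iota ltnn => /(_ isT).
have exl : exists l, (l <= t0)%N && all (fun t => line o f t \in s) (iota l (t0.+1 - l)).
  by exists t0; rewrite leqnn subSnn /= t0s.
case: (ex_minnP exh) => h /andP[lt0h hs] minh.
case: (ex_minnP exl) => l /andP[ll0 /allP ls] minl.
exists (Strip o f l h); split; rewrite ?ll0 //; split=> //=; rewrite /strip_cell /=.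
- exact: leq_ltn_trans lt0h.
- move=> t /andP[lelt ltth]; have [let0|lt0t] := leqP t t0.
    by apply: ls; rewrite mem_iota lelt subnKC ?ltnS // (leq_trans ll0).
  by apply/negPn/negP => ns; have := minh t; rewrite lt0t ns => /(_ isT); rewrite leqNgt ltth.
- move=> t tl; apply/negP => ts; have := minl t; rewrite -tl ltnn => h'; suff: false by [].
  apply: h'; rewrite (ltnW _) ?tl //=; apply/allP => u; rewrite mem_iota => /andP[letu ltu].
  have [->//|ne] := eqVneq u t; apply: ls; rewrite mem_iota.
  by move: letu ltu ne tl ll0; lia.
Qed.

Section Owners.
Variable s : seq (nat * nat).
Hypothesis lo_s : leaf_order s.

(** Since the newest cell comes first, the condition says that [C] is the oldest cell of the
    strip. *)
Definition owns S C := [/\ maximal_strip s S, C \in s &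
  exists t0, [/\ (lo S <= t0 < hi S)%N, strip_cell S t0 = C &
  forall t, (lo S <= t < hi S)%N -> t != t0 -> (index (strip_cell S t) s < index C s)%N]].

(** A cell has at most one older neighbour, so once the neighbours of position [t0] are younger, the
    cells get younger all the way to both ends. *)
Lemma younger_strip S t0 : maximal_strip s S -> (lo S <= t0 < hi S)%N ->
  (forall t, (t == t0.+1) || (t0 == t.+1) -> strip_cell S t \in s ->
    (index (strip_cell S t) s < index (strip_cell S t0) s)%N) ->
  forall t, (lo S <= t < hi S)%N -> t != t0 ->
    (index (strip_cell S t) s < index (strip_cell S t0) s)%N.
Proof.
move=> [_ Ss _ _] /andP[lo0 hi0] nb.
pose ix t := index (strip_cell S t) s.
have step u v w : strip_cell S u \in s -> strip_cell S v \in s -> strip_cell S w \in s ->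
    u != w -> nadj (strip_cell S v) (strip_cell S u) -> nadj (strip_cell S v) (strip_cell S w) ->
    (ix v < ix u)%N -> (ix w < ix v)%N.
  move=> us vs ws uw adju adjw lt; rewrite ltnNge leq_eqVlt; apply/negP => /orP[/eqP e|ltw].
    have e' : strip_cell S v = strip_cell S w by rewrite -[LHS](nth_index (0, 0)%N vs) -/(ix v) e nth_index.
    by move: adjw; rewrite e' nadj_irr.
  have := leaf_order_older lo_s us ws adju adjw lt ltw.
  by move/line_inj/eqP; apply/negP.
have up k : (t0 + k.+1 < hi S)%N -> (ix (t0 + k.+1) < ix (t0 + k))%N.
  elim: k => [|k IHk] lt.
    by rewrite addn0; apply: nb; rewrite ?addn1 ?eqxx ?Ss //; lia.
  apply: (step (t0 + k)%N); rewrite ?Ss ?IHk //; try lia.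
    by rewrite addnS nadj_sym; apply: nadj_line.
  by rewrite [(t0 + k.+2)%N]addnS; apply: nadj_line.
have down k : (lo S + k.+1 <= t0)%N -> (ix (t0 - k.+1) < ix (t0 - k))%N.
  elim: k => [|k IHk] lt.
    by rewrite subn0; apply: nb; rewrite ?Ss //; lia.
  have e1 : (t0 - k = (t0 - k.+1).+1)%N by lia.
  have e2 : (t0 - k.+1 = (t0 - k.+2).+1)%N by lia.
  apply: (step (t0 - k)%N); rewrite ?Ss ?IHk //; try lia.
    by rewrite e1; apply: nadj_line.
  by rewrite e2 nadj_sym; apply: nadj_line.
move=> t /andP[lot hit] ne.
have [ltt|lett] := ltnP t0 t.
  have [k e] : exists k, t = (t0 + k.+1)%N by exists (t - t0).-1; lia.
  rewrite {}e in hit *; elim: k hit => [|k IHk] hit.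
    by have := up 0%N hit; rewrite addn0.
  by apply: ltn_trans (up _ hit) (IHk _); lia.
have [k e lek] : exists2 k, t = (t0 - k.+1)%N & (lo S + k.+1 <= t0)%N.
  by exists (t0 - t).-1; lia.
rewrite {}e {ne lot hit lett}; elim: k lek => [|k IHk] lek.
  by have := down 0%N lek; rewrite subn0.
by apply: ltn_trans (down _ lek) (IHk _); lia.
Qed.

(** On a line through [C] that avoids its possible older neighbour, the neighbours of [C] are
    younger. *)
Lemma owner_exists C : C \in s -> exists S, owns S C.
Proof.
move=> Cs.
suff [o [f [t0 [eC nb]]]] : exists o f t0, C = line o f t0 /\
    forall t, (t == t0.+1) || (t0 == t.+1) -> line o f t \in s ->
      (index (line o f t) s < index C s)%N.
  have [|S [mS vS pS inS]] := @maximal_strip_exists s o f t0; first by rewrite -eC.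
  have eS t : strip_cell S t = line o f t by rewrite /strip_cell vS pS.
  exists S; split=> //; exists t0; rewrite eS -eC; split=> // t int ne.
  rewrite [in X in (_ < X)%N]eC -eS; apply: younger_strip => // t' nbt'.
  by rewrite !eS -eC; apply: nb.
have idx_ne D : D \in s -> D != C -> ~~ (index C s < index D s)%N -> (index D s < index C s)%N.
  move=> Ds ne; rewrite -leqNgt leq_eqVlt => /orP[/eqP e|//].
  by move: ne; rewrite -(nth_index (0, 0)%N Ds) e nth_index // eqxx.
have [/hasP[F Fs /andP[adjF ltF]]|/hasPn noF] :=
  boolP (has (fun F => nadj C F && (index C s < index F s)%N) s).
  case: C F Fs adjF ltF Cs idx_ne => [c1 c2] [f1 f2] Fs adjF ltF Cs idx_ne.
  (* The line is perpendicular to the direction from [C] to its older neighbour: vertical when that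
     neighbour lies in the same row. *)
  exists (f2 == c2), (if f2 == c2 then c1 else c2), (if f2 == c2 then c2 else c1).
  case: ifP => hv; (split=> // t nbt ts; apply: idx_ne => //=;
      [by rewrite xpair_eqE; lia | apply/negP => lt]).
    have : (f1, f2) = line true c1 t.
      apply: leaf_order_older lo_s Fs ts adjF _ ltF lt.
      by rewrite /nadj /zadj /=; lia.
    by case=> e1 e2; move: adjF; rewrite /nadj /zadj /= e1; lia.
  have : (f1, f2) = line false c2 t.
    apply: leaf_order_older lo_s Fs ts adjF _ ltF lt.
    by rewrite /nadj /zadj /=; lia.
  by case=> e1 e2; move: hv; rewrite e2 eqxx.
case: C Cs idx_ne noF => c1 c2 Cs idx_ne noF.
exists true, c1, c2; split=> // t nbt ts; apply: idx_ne => //=; first by rewrite xpair_eqE; lia.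
apply/negP => lt; have := noF _ ts; rewrite lt andbT /nadj /zadj /=; lia.
Qed.

Lemma owner_inj S C C' : owns S C -> owns S C' -> C = C'.
Proof.
move=> [_ _ [t [it <- yt]]] [_ _ [t' [it' <- yt']]].
have [->//|ne] := eqVneq t t'.
have := yt t' it'; rewrite eq_sym ne => /(_ isT) lt.
by have := yt' t it ne; rewrite ltnNge ltnW.
Qed.

Lemma maximal_strip_eq S S' : maximal_strip s S -> maximal_strip s S' ->
  vert S = vert S' -> pos S = pos S' -> (lo S == lo S') || (hi S == hi S') -> S = S'.
Proof.
case: S S' => [o f l h] [o' f' l' h'] [/= lh Ss hS lS] [/= lh' Ss' hS' lS'] eo ef; subst o' f'.
rewrite /strip_cell /= in Ss Ss' hS hS' lS lS'.
have hle : forall l1 h1 l2 h2, (l1 < h1)%N -> (forall t, (l2 <= t < h2)%N -> line o f t \in s) ->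
    line o f h1 \notin s -> l1 = l2 -> (h2 <= h1)%N.
  move=> l1 h1 l2 h2 lh1 Ss2 hs1 el; rewrite leqNgt; apply: contra hs1 => lt.
  by apply: Ss2; rewrite lt andbT -el ltnW.
have lle : forall l1 h1 l2 h2, (l1 < h1)%N -> (forall t, (l2 <= t < h2)%N -> line o f t \in s) ->
    (forall t, t.+1 = l1 -> line o f t \notin s) -> h1 = h2 -> (l1 <= l2)%N.
  move=> l1 h1 l2 h2 lh1 Ss2 ls1 eh; case: l1 lh1 ls1 => // l1 lh1 ls1.
  rewrite ltnNge; apply: contra (ls1 l1 erefl) => le; apply: Ss2.
  by rewrite le -eh ltnW.
case/orP => /eqP e; subst.
  by congr Strip; apply/eqP; rewrite eqn_leq;
    rewrite (hle _ _ _ _ lh Ss' hS erefl) (hle _ _ _ _ lh' Ss hS' erefl).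
by congr Strip; apply/eqP; rewrite eqn_leq;
  rewrite (lle _ _ _ _ lh Ss' lS erefl) (lle _ _ _ _ lh' Ss lS' erefl).
Qed.

End Owners.

(** * Leading corners of maximal strips *)

Definition strip_ll S := line (vert S) (pos S) (lo S).
Definition strip_ur S := line (vert S) (pos S).+1 (hi S).

(* The leading pair of corners: diagonal for a horizontal strip, anti-diagonal for a
   vertical one.  With this choice every vertex is a leading corner of one strip only. *)
Definition lead1 S := if vert S then ((pos S).+1, lo S) else (lo S, pos S).
Definition lead2 S := if vert S then (pos S, hi S) else (hi S, (pos S).+1).
Definition trail1 S := if vert S then (pos S, lo S) else (hi S, pos S).
Definition trail2 S := if vert S then ((pos S).+1, hi S) else (lo S, (pos S).+1).

Section Corners.
Variable s : seq (nat * nat).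
Hypothesis diagonal : forall x y, (x, y) \in s -> (x.+1, y.+1) \in s ->
  ((x.+1, y) \in s) || ((x, y.+1) \in s).
Hypothesis antidiagonal : forall x y, (x.+1, y) \in s -> (x, y.+1) \in s ->
  ((x, y) \in s) || ((x.+1, y.+1) \in s).

Lemma first_cell S : maximal_strip s S -> strip_cell S (lo S) \in s.
Proof. by case=> lh Ss _ _; rewrite Ss // leqnn. Qed.

Lemma last_cell S : maximal_strip s S -> exists2 h, hi S = h.+1 & strip_cell S h \in s.
Proof.
case=> lh Ss _ _; exists (hi S).-1; first by lia.
by apply: Ss; lia.
Qed.

(** If a vertical and a horizontal strip shared this corner, the first cell of the vertical one
    would prolong the horizontal one downwards, against maximality. *)
Lemma lead1_inj S S' : maximal_strip s S -> maximal_strip s S' -> lead1 S = lead1 S' -> S = S'.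
Proof.
move=> mS mS' e; suff [eo [ef el]] : vert S = vert S' /\ pos S = pos S' /\ lo S = lo S'.
  by apply: (maximal_strip_eq mS) => //; rewrite el eqxx.
have := first_cell mS; have := first_cell mS'; move: mS mS' e; rewrite /lead1.
case: S S' => [[] f l h] [[] f' l' h'] /= [_ _ _ lS] [_ _ _ lS'];
  rewrite /strip_cell /= in lS lS' * => -[e1 e2] c' c.
- by case: e1.
- by have := lS' f e1; rewrite -e2 c.
- by have := lS f' (esym e1); rewrite e2 c'.
- by [].
Qed.

(** The same conflict at the upper end: the last cell of the vertical strip would follow the last
    cell of the horizontal one. *)
Lemma lead2_inj S S' : maximal_strip s S -> maximal_strip s S' -> lead2 S = lead2 S' -> S = S'.
Proof.
move=> mS mS' e; suff [eo [ef el]] : vert S = vert S' /\ pos S = pos S' /\ hi S = hi S'.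
  by apply: (maximal_strip_eq mS) => //; rewrite el eqxx orbT.
have [x ex] := last_cell mS; have [y ey] := last_cell mS'; move: mS mS' e ex ey; rewrite /lead2.
case: S S' => [[] f l h] [[] f' l' h'] /= [_ _ hS _] [_ _ hS' _];
  rewrite /strip_cell /= in hS hS' * => -[e1 e2] ex ey cy cx; first by rewrite e1 e2.
- move: hS'; rewrite -e1; have [->] : f'.+1 = x.+1 by rewrite -e2.
  by rewrite cx.
- move: hS; rewrite e1; have [->] : f.+1 = y.+1 by rewrite e2.
  by rewrite cy.
- by case: e2 => ->; rewrite e1.
Qed.

(** For strips of different orientation, a cell of one would prolong the other. For equal
    orientations two cells would be opposite at this vertex, and the third cell then provided by the
    hypotheses would prolong one of the strips. *)
Lemma lead12_neq S S' : maximal_strip s S -> maximal_strip s S' -> lead1 S != lead2 S'.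
Proof.
move=> mS mS'; apply/negP => /eqP.
have := first_cell mS; have [y] := last_cell mS'; move: mS mS'; rewrite /lead1 /lead2.
case: S S' => [[] f l h] [[] f' l' h'] /= [_ _ _ lS] [_ _ hS' _];
  rewrite /strip_cell /= in lS hS' * => ey cy c [e1 e2].
- subst; have := @antidiagonal f y cy c; rewrite (negPf hS').
  by rewrite (negPf (lS y erefl)).
- have ef : f = y by lia.
  by move: (lS f' (esym e2)); rewrite ef cy.
- by move: hS'; rewrite -e1 -e2 c.
- subst; have := @diagonal y f' cy c; rewrite (negPf hS').
  by rewrite (negPf (lS y erefl)).
Qed.

End Corners.

(** * Weights making the chosen corners leading *)

Lemma sum_pow2_lt l k : uniq l -> (forall i, i \in l -> (i < k)%N) ->
  (\sum_(i <- l) 2 ^ i < 2 ^ k)%N.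
Proof.
move=> ul lt; apply: (@leq_ltn_trans (\sum_(i <- iota 0 k) 2 ^ i)).
  apply: (@sub_le_big_seq _ addn leq) => [//|x y|i]; first exact: leq_addr.
  rewrite !count_uniq_mem ?iota_uniq // mem_iota /=.
  by case: (boolP (i \in l)) => // /lt ->.
elim: k {lt ul} => [|k IHk]; first by rewrite big_nil.
by rewrite -[k.+1]addn1 iotaD /= big_cat big_seq1 /= addn1 expnS mul2n -addnn ltn_add2r.
Qed.

Section Weights.
Variable s : seq (nat * nat).
Hypothesis lo_s : leaf_order s.
Variable J : nat * nat -> strip.
Hypothesis ownJ : forall C, C \in s -> owns s (J C) C.

Lemma strip_curv w S : (lo S <= hi S)%N ->
  \sum_(lo S <= t < hi S) curv w (strip_cell S t) =
  w (strip_ll S) + w (strip_ur S)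
    - w (line (vert S) (pos S).+1 (lo S)) - w (line (vert S) (pos S) (hi S)).
Proof.
move=> le; rewrite /strip_cell /strip_ll /strip_ur; case: (vert S) => /=.
  by rewrite -curv_sum // big_nat1.
rewrite addrAC -curv_sum //; apply: eq_bigr => t _.
by rewrite big_nat1.
Qed.

Lemma weights_exist : exists w : nat * nat -> int, forall C, C \in s ->
  w (trail1 (J C)) + w (trail2 (J C)) < w (lead1 (J C)) + w (lead2 (J C)).
Proof.
(* The sign is negative for vertical strips, whose leading pair is anti-diagonal; older cells have
   larger curvature in absolute value. *)
pose delta C : int := (-1) ^+ vert (J C) * (2 ^ index C s)%:Z.
have [B [N [_ _ _ /(_ (fun _ => 0) delta) [w [_ wD]]]]] := curv_extension lo_s.
exists w => C Cs; have [mS _ [t0 [it0 eC yt]]] := ownJ Cs.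
set S := J C in mS it0 eC yt *; have [lh Ss _ _] := mS.
have := strip_curv w (ltnW lh).
rewrite (bigD1_seq t0) ?mem_index_iota ?iota_uniq //= eC wD // /delta -/S.
set r := \sum_(_ <- _ | _) _.
(* The other cells of the strip have distinct smaller indices, so the owned cell dominates their
   sum. *)
have rlt : `|r| < (2 ^ index C s)%:Z.
  rewrite /r -big_filter; set ts := filter _ _.
  have tsP t : t \in ts -> (lo S <= t < hi S)%N /\ t != t0.
    by rewrite mem_filter mem_index_iota => /andP[].
  apply: le_lt_trans (ler_norm_sum _ _ _) _.
  rewrite (eq_big_seq (fun t => (2 ^ index (strip_cell S t) s)%N%:Z)); last first.
    move=> t /tsP[it _]; rewrite wD ?Ss // /delta normrM normrX normrN1 expr1n mul1r.
    by rewrite ger0_norm.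
  rewrite -(big_morph Posz (fun a b => erefl) (erefl 0)) ltz_nat -(big_map _ xpredT (fun i => 2 ^ i)%N).
  apply: sum_pow2_lt => [|_ /mapP[t /tsP[it ne] ->]]; last exact: yt.
  rewrite map_inj_in_uniq ?filter_uniq ?iota_uniq // => t t' /tsP[it _] /tsP[it' _] e.
  apply: (@line_inj (vert S) (pos S)); rewrite -[LHS](nth_index (0, 0)%N (Ss _ it)) e.
  exact: nth_index (Ss _ it').
rewrite /lead1 /lead2 /trail1 /trail2 /strip_ll /strip_ur.
by case: (vert S) rlt => /=; rewrite ?expr0 ?expr1; lia.
Qed.

End Weights.

(** * Monomial ideals and weight orders *)

Lemma ideal_gen_sub (R : comNzRingType) (G I : R -> Prop) :
  is_ideal I -> (forall g, G g -> I g) -> sub_ideal (ideal_gen G) I.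
Proof.
move=> [I0 ID IM] GI u [t [tG ->]]; elim: t tG => [|cg t IHt] tG; first by rewrite big_nil.
rewrite big_cons; apply: ID; first by apply/IM/GI/tG; rewrite inE eqxx.
by apply: IHt => cg' cg't; apply: tG; rewrite inE cg't orbT.
Qed.

Lemma ideal_gen_mono (R : comNzRingType) (G G' : R -> Prop) :
  (forall g, G g -> G' g) -> sub_ideal (ideal_gen G) (ideal_gen G').
Proof. by move=> GG' u [t [tG ->]]; exists t; split=> // cg /tG/GG'. Qed.

Lemma ideal_gen_in (R : comNzRingType) (G : R -> Prop) g : G g -> ideal_gen G g.
Proof.
move=> Gg; exists [:: (1, g)]; split; last by rewrite big_seq1 mul1r.
by move=> cg; rewrite inE => /eqP ->.
Qed.

Section Monomials.
Variables (n : nat) (K : fieldType).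
Implicit Types (u f : {mpoly K[n]}) (m : 'X_{1..n}) (M : seq 'X_{1..n}).

Lemma mnm1D_eq (i j k l : 'I_n) : (U_(i) + U_(j) = U_(k) + U_(l))%MM ->
  (i = k /\ j = l) \/ (i = l /\ j = k).
Proof.
move=> E; have e v := congr1 (fun m : 'X_{1..n} => m v) E.
suff: (i == k) && (j == l) || (i == l) && (j == k).
  by case/orP => /andP[/eqP -> /eqP ->]; [left|right].
have := e i; have := e k; have := e l; have := e j; rewrite !mnmDE !mnm1E !eqxx.
rewrite [l == k]eq_sym [k == j]eq_sym [l == j]eq_sym [j == i]eq_sym [k == i]eq_sym [l == i]eq_sym.
by case: (i == k); case: (j == l); case: (i == l); case: (j == k); case: (k == l); case: (i == j).
Qed.

Lemma mem_msuppMX u m m' : m' \in msupp (u * 'X_[m]) ->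
  exists2 m0, m0 \in msupp u & m' = (m + m0)%MM.
Proof. by rewrite (perm_mem (msuppMX _ _)) => /mapP[m0 m0u ->]; exists m0. Qed.

(** Membership in a monomial ideal is decided monomial by monomial; conversely each monomial is
    assigned to the first generator dividing it. *)
Lemma monomial_idealP M u :
  ideal_gen (fun g => g \in [seq 'X_[m] | m <- M]) u <->
  (forall m, m \in msupp u -> exists2 m', m' \in M & (m' <= m)%MM).
Proof.
split=> [[t [tM ->]] m|].
  move/msupp_sum_le/flattenP => [_ /mapP[[c g] + ->]]; rewrite mem_filter /= => /tM /=.
  by move=> /mapP[m' m'M ->] /mem_msuppMX[m0 _ ->]; exists m' => //; apply: lem_addr.
move=> supp; pose d m := nth 0%MM M (find (fun m' => (m' <= m)%MM) M).
have dP m : m \in msupp u -> d m \in M /\ (d m <= m)%MM.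
  move=> /supp[m' m'M le]; have h : has (fun m' => (m' <= m)%MM) M by apply/hasP; exists m'.
  by split; [rewrite mem_nth // -has_find | apply: (nth_find 0%MM h)].
exists [seq (u@_m *: 'X_[(m - d m)%MM], 'X_[d m]) | m <- msupp u]; split.
  by move=> _ /mapP[m mu ->] /=; apply: map_f; case: (dP m mu).
rewrite big_map {1}(mpolyE u); apply: eq_big_seq => m mu /=.
by rewrite -scalerAl -mpolyXD submK //; case: (dP m mu).
Qed.

(** If a product with the i-th monomial is divisible by an earlier one, coprimality moves the
    divisibility to the other factor. *)
Lemma regular_monomials M :
  (forall i j, (i < size M)%N -> (j < i)%N ->
    forall v, nth 0%MM M i v = 0%N \/ nth 0%MM M j v = 0%N) ->
  (forall m, m \in M -> m != 0%MM) ->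
  regular_sequence [seq 'X_[m] : {mpoly K[n]} | m <- M].
Proof.
move=> cop nz; split=> [i|]; last first.
  move/monomial_idealP => /(_ 0%MM); rewrite msupp1 inE eqxx => /(_ isT) [m mM /mnm_lepP le].
  by move/eqP: (nz m mM); apply; apply/mnmP => v; apply/eqP; rewrite mnm0E -leqn0 -(mnm0E v).
rewrite size_map => lti u; rewrite -map_take => /monomial_idealP h.
apply/monomial_idealP => m mu.
have [|m' m't /mnm_lepP le] := h (nth 0%MM M i + m)%MM.
  by rewrite (nth_map 0%MM) // mulrC (perm_mem (msuppMX _ _)) map_f.
exists m' => //; have [j] := nthP 0%MM m't; rewrite size_takel ?(ltnW lti) // => ltj ej.
rewrite nth_take // in ej; apply/mnm_lepP => v; have := le v; rewrite mnmDE -ej.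
by case: (cop i j lti ltj v) => ->.
Qed.

Lemma mcoeffMX_eq0 u m m0 : mdeg m = mdeg m0 -> m != m0 -> (u * 'X_[m])@_m0 = 0.
Proof.
move=> dm ne; apply: memN_msupp_eq0; apply: contra ne => /mem_msuppMX[m' _ e].
have /eqP : mdeg m' = 0%N by move/(congr1 (@mdeg n)): e; rewrite mdegD dm; lia.
by rewrite mdeg_eq0 => /eqP m'0; rewrite e m'0 addm0.
Qed.

Section Order.
Variable le : rel 'X_{1..n}.
Hypothesis leP : monomial_order le.

(** The default value of the fold is harmless, being the least monomial. *)
Lemma initial_monomial_max f m : m \in msupp f -> (forall m', m' \in msupp f -> le m' m) ->
  initial_monomial le f = 'X_[m].
Proof.
have [tot trans anti le0 _] := leP; have refl x : le x x by have := tot x x; rewrite orbb.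
move=> mf ub; rewrite /initial_monomial; congr 'X_[_]; elim: (msupp f) mf ub => //= x l IHl.
set big := \big[_/_]_(_ <- l) _ in IHl *; rewrite inE => + ub; rewrite big_cons.
have [ml _|ml /orP[/eqP e|//]] := boolP (m \in l).
  by rewrite -/big IHl ?ub ?inE ?eqxx // => m' m'l; apply: ub; rewrite inE m'l orbT.
subst x; have lem : le big m.
  rewrite /big; elim: (l) ub {IHl big ml} => [|y l' IHl'] ub; first by rewrite big_nil.
  rewrite big_cons; set b := bigop _ _ _ in IHl' *.
  have uy : le y m by apply: ub; rewrite !inE eqxx orbT.
  have ub' : le b m by apply: IHl' => z; rewrite inE => /predU1P[->//|zl]; apply: ub; rewrite !inE zl !orbT.
  by case: ifP.
by rewrite -/big; case: ifP => // le'; apply: anti; rewrite lem le'.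
Qed.

End Order.

(** Ties in weight are broken by the library order on monomials. *)
Definition weight_le (w : 'I_n -> nat) : rel 'X_{1..n} :=
  fun m1 m2 => (weight w m1 < weight w m2)%N || ((weight w m1 == weight w m2) && (m1 <= m2)%O).

Lemma weight_le_order w : monomial_order (weight_le w).
Proof.
rewrite /weight_le; split.
- move=> m1 m2; case: ltngtP => //= _; exact: le_total.
- move=> m2 m1 m3 /orP[lt12|/andP[/eqP e12 le12]] /orP[lt23|/andP[/eqP e23 le23]]; apply/orP.
  + by left; apply: ltn_trans lt23.
  + by left; rewrite -e23.
  + by left; rewrite e12.
  + by right; rewrite e12 e23 eqxx (le_trans le12).
- move=> m1 m2 /andP[/orP[lt12|/andP[/eqP e12 le12]] /orP[lt21|/andP[/eqP e21 le21]]]; try lia.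
  by apply: le_anti; rewrite le12.
- move=> m; have -> : weight w 0%MM = 0%N by rewrite /weight big1 // => i _; rewrite mnm0E.
  by case: (weight w m) => //=; rewrite le0m.
- move=> m m1 m2; rewrite !weightD ltn_add2l eqn_add2l lemc_add2r //.
Qed.

End Monomials.

(** * Inner minors *)

Section Variables.
Variables (K : fieldType) (P : {fset nat * nat}).
Local Notation n := #|{: vertices P}|.
Local Notation S := (polyomino_ring K P).

Lemma mem_vertices v : reflect (exists2 C, C \in P & v \in cell_vertices C) (v \in vertices P).
Proof.
rewrite /vertices; apply: (iffP (bigfcupP _ _ _ _)) => [[C /andP[CP _] vC]|[C CP vC]]; exists C => //.
by rewrite CP.
Qed.

Definition vtx (i : 'I_n) : nat * nat := val (enum_val i : vertices P).

Lemma vtx_inj : injective vtx.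
Proof. by move=> i j /val_inj/enum_val_inj. Qed.

Lemma vtx_in i : vtx i \in vertices P.
Proof. exact: valP. Qed.

Lemma vtx_onto v : v \in vertices P -> exists i, vtx i = v.
Proof.
move=> vP; exists (enum_rank ([` vP]%fset : vertices P)).
by rewrite /vtx enum_rankK.
Qed.

Lemma xvar_vtx i : xvar K P (vtx i) = 'X_i.
Proof. by rewrite /xvar /vtx valK enum_valK. Qed.

Lemma inner_corners a b : inner_interval P a b -> exists i j k l,
  [/\ vtx i = a, vtx j = b, vtx k = (b.1, a.2) & vtx l = (a.1, b.2)].
Proof.
case: a b => [a1 a2] [b1 b2] [/andP[/= lt1 lt2] inP].
have cell x y : (a1 <= x < b1)%N -> (a2 <= y < b2)%N -> (x, y) \in P.
  by move=> hx hy; apply: inP; rewrite /le2 /= -?[(_ + _)%R]/(_ + _)%N; lia.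
have vert x y : (a1 <= x < b1)%N -> (a2 <= y < b2)%N -> forall v, v \in cell_vertices (x, y) ->
    exists i, vtx i = v.
  by move=> hx hy v vC; apply/vtx_onto/mem_vertices; exists (x, y); rewrite ?cell.
have [|||i ei] := vert a1 a2 _ _ (a1, a2); rewrite ?mem_cell_vertices_nat /=; try lia.
have [|||j ej] := vert b1.-1 b2.-1 _ _ (b1, b2); rewrite ?mem_cell_vertices_nat /=; try lia.
have [|||k ek] := vert b1.-1 a2 _ _ (b1, a2); rewrite ?mem_cell_vertices_nat /=; try lia.
have [|||l el] := vert a1 b2.-1 _ _ (a1, b2); rewrite ?mem_cell_vertices_nat /=; try lia.
by exists i, j, k, l.
Qed.

Lemma minorE a b i j k l : vtx i = a -> vtx j = b -> vtx k = (b.1, a.2) -> vtx l = (a.1, b.2) ->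
  minor K P (a, b) = 'X_[U_(i) + U_(j)] - 'X_[U_(k) + U_(l)].
Proof. by move=> ei ej ek el; rewrite /minor -ek -el -ei -ej !xvar_vtx !mpolyXD. Qed.

(** By degree, the diagonal monomial would have to occur in the other minor itself; but a diagonal
    pair determines its interval and is never an anti-diagonal pair. *)
Lemma mcoeff_minor_neq u a b a' b' i j : inner_interval P a b -> inner_interval P a' b' ->
  vtx i = a -> vtx j = b -> (a', b') != (a, b) -> (u * minor K P (a', b'))@_(U_(i) + U_(j)) = 0.
Proof.
move=> ab ab' ei ej ne; have [i' [j' [k' [l' [ei' ej' ek' el']]]]] := inner_corners ab'.
case: ab ab' => /andP[lt1 lt2] _ [/andP[lt1' lt2'] _].
rewrite (minorE ei' ej' ek' el') mulrBr mcoeffB !mcoeffMX_eq0 ?subr0 ?mdegD ?mdeg1 //.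
  apply/eqP => /mnm1D_eq[] [e1 e2]; have := congr1 vtx e1; have := congr1 vtx e2.
    by rewrite ei ej ek' el' => e3 e4; subst; rewrite -e3 -e4 /= in lt1; lia.
  by rewrite ei ej ek' el' => e3 e4; subst; rewrite -e3 -e4 /= in lt2; lia.
apply/eqP => /mnm1D_eq[] [e1 e2]; have := congr1 vtx e1; have := congr1 vtx e2.
  by rewrite ei ej ei' ej' => e3 e4; rewrite e3 e4 eqxx in ne.
by rewrite ei ej ei' ej' => e3 e4; subst; lia.
Qed.

Lemma mcoeff_minor a b i j : inner_interval P a b -> vtx i = a -> vtx j = b ->
   (minor K P (a, b))@_(U_(i) + U_(j)) = 1.
Proof.
move=> ab ei ej; have [i' [j' [k [l [ei' ej' ek el]]]]] := inner_corners ab.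
case: ab => /andP[lt1 lt2] _; rewrite (minorE ei ej ek el) mcoeffB !mcoeffX eqxx.
case: eqP => [/mnm1D_eq|_]; last by rewrite subr0.
case=> -[e1 e2]; have := congr1 vtx e1; have := congr1 vtx e2; rewrite ei ej ek el => e3 e4.
  by rewrite -e3 /= in lt1; lia.
by rewrite -e3 /= in lt2; lia.
Qed.

Definition innerb ab : bool :=
  if excluded_middle_informative (inner_interval P ab.1 ab.2) then true else false.

Lemma innerbP ab : reflect (inner_interval P ab.1 ab.2) (innerb ab).
Proof. by rewrite /innerb; case: excluded_middle_informative => h; constructor. Qed.

Definition inner_minors : seq S :=
  map (minor K P) (filter innerb [seq (a, b) | a <- vertices P, b <- vertices P]).

Lemma inner_minorsP f : f \in inner_minors <-> inner_minor f.
Proof.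
split=> [/mapP[[a b] + ->]|[a [b [ab ->]]]].
  by rewrite mem_filter => /andP[/innerbP ab _]; exists a, b.
apply: map_f; rewrite mem_filter; apply/andP; split; first exact/innerbP.
have [i [j [_ [_ [<- <- _ _]]]]] := inner_corners ab.
by apply: allpairs_f; apply: vtx_in.
Qed.

(** The diagonal monomial of a minor has coefficient 1 in it and 0 in every combination of the other
    minors. *)
Lemma inner_minors_minimal :
  minimal_homogeneous_generators (@polyomino_ideal K P) inner_minors.
Proof.
split.
- apply/allP => f /inner_minorsP[a [b [ab ->]]].
  have [i [j [k [l [ei ej ek el]]]]] := inner_corners ab.
  apply/homogP; exists 2; rewrite (minorE ei ej ek el).
  by rewrite rpredB // dhomogX /= mdegD !mdeg1.
- by move=> f; split; apply: ideal_gen_mono => g /inner_minorsP.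
- move=> g gG same; have /inner_minorsP[a [b [ab eg]]] := gG.
  have [i [j [_ [_ [ei ej _ _]]]]] := inner_corners ab.
  have [t [tG]] : ideal_gen (fun f => f \in inner_minors /\ f != g) g.
    by apply/same/ideal_gen_in/inner_minorsP.
  rewrite {1}eg => /(congr1 (mcoeff (U_(i) + U_(j))%MM)).
  rewrite mcoeff_minor // raddf_sum /= big_seq big1 => [/eqP|[c f] /tG[/= fG ne]].
    by rewrite oner_eq0.
  have /inner_minorsP[a' [b' [ab' ef]]] := fG.
  rewrite ef (mcoeff_minor_neq _ ab ab' ei ej) //.
  by apply: contraNneq ne => -[ea eb]; rewrite ef eg ea eb.
Qed.

End Variables.

(** * Height and Koenig type of a tree *)

Section MonomialMap.
Variables (n : nat) (K : fieldType) (mu : 'I_n -> 'X_{1..n}).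

Definition monomial_map : {rmorphism {mpoly K[n]} -> {mpoly K[n]}} :=
  mmap (@mpolyC n K) (fun i => 'X_[mu i]).

Definition exponent (m : 'X_{1..n}) : 'X_{1..n} := (\sum_i mu i *+ m i)%MM.

Lemma monomial_map_C c : monomial_map c%:MP = c%:MP.
Proof. by rewrite /monomial_map /= mmapC. Qed.

Lemma monomial_map_X m : monomial_map 'X_[m] = 'X_[exponent m].
Proof. by rewrite /monomial_map /= mmapX /mmap1 mprodXnE. Qed.

Lemma exponentE m t : exponent m t = (\sum_i mu i t * m i)%N.
Proof. by rewrite /exponent mnm_sumE; apply: eq_bigr => i _; rewrite mulmnE. Qed.

Lemma exponentD m m' : exponent (m + m') = (exponent m + exponent m')%MM.
Proof.
apply/mnmP => t; rewrite mnmDE !exponentE -big_split; apply: eq_bigr => i _.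
by rewrite mnmDE mulnDr.
Qed.

Lemma exponent1 i : exponent U_(i) = mu i.
Proof.
apply/mnmP => t; rewrite exponentE (bigD1 i) //= mnm1E eqxx muln1 big1 ?addn0 // => j ne.
by rewrite mnm1E eq_sym (negPf ne) muln0.
Qed.

(** Distinct monomials in x_B have distinct images, so no terms can cancel. *)
Lemma monomial_map_inj (B : {set 'I_n}) :
  (forall m m' : 'X_{1..n}, (forall i, i \notin B -> m i = 0%N) ->
    (forall i, i \notin B -> m' i = 0%N) -> exponent m = exponent m' -> m = m') ->
  independent B (fun f => monomial_map f = 0).
Proof.
move=> inj f sf f0; apply/mpolyP => m; rewrite mcoeff0; apply/eqP; apply: contraT.
rewrite -mcoeff_msupp => mf; have := congr1 (mcoeff (exponent m)) f0.
rewrite mcoeff0 {1}(mpolyE f).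
have -> : monomial_map (\sum_(m <- msupp f) f@_m *: 'X_[m]) =
    \sum_(m <- msupp f) f@_m *: 'X_[exponent m].
  rewrite (rmorph_sum monomial_map); apply: eq_bigr => m' _.
  by rewrite -mul_mpolyC rmorphM /= monomial_map_C monomial_map_X mul_mpolyC.
rewrite raddf_sum /= (bigD1_seq m) ?msupp_uniq //= mcoeffZ mcoeffX eqxx mulr1.
rewrite big_seq_cond big1 ?addr0 => [e|m' /andP[m'f ne]]; first by rewrite mcoeff_msupp e eqxx in mf.
rewrite mcoeffZ mcoeffX; case: eqP => [e|_]; last by rewrite mulr0.
by rewrite (inj m' m) ?eqxx // in ne; [apply: sf | apply: sf].
Qed.

End MonomialMap.

(** * A toric prime containing the polyomino ideal *)

Section Konig.
Variables (K : fieldType) (P : {fset nat * nat}).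
Local Notation n := #|{: vertices P}|.
Local Notation S := (polyomino_ring K P).
Variable s : seq (nat * nat).
Hypotheses (lo_s : leaf_order s) (sP : s =i P).

Lemma polyomino_ideal_sub (I : S -> Prop) : is_ideal I ->
  (forall a b, inner_interval P a b -> I (minor K P (a, b))) -> sub_ideal (@polyomino_ideal K P) I.
Proof. by move=> idI minI; apply: ideal_gen_sub => // _ [a [b [ab ->]]]; apply: minI. Qed.

Lemma flat_interval (w : nat * nat -> int) a b : (forall C, C \in P -> curv w C = 0) ->
  inner_interval P a b -> w a + w b = w (b.1, a.2) + w (a.1, b.2).
Proof.
case: a b => [a1 a2] [b1 b2] flat [/andP[/= lt1 lt2] inP].
have := curv_sum w (ltnW lt1) (ltnW lt2); rewrite big_nat big1; first by lia.
move=> i /andP[ai ib]; rewrite big_nat big1 // => j /andP[aj jb]; apply: flat.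
by apply: inP; rewrite /le2 /= -?[(_ + _)%R]/(_ + _)%N; lia.
Qed.

(** Functions of zero curvature are balanced on all inner intervals, so as exponents they define a
    monomial map killing every inner minor. They are free on [B], which makes those variables
    independent. *)
Lemma toric_prime : exists (p : S -> Prop) (B : {set 'I_n}),
  [/\ is_prime_ideal p, sub_ideal (@polyomino_ideal K P) p, independent B p &
      (#|B| + size s = n)%N].
Proof.
have [B [N [uBN sN memBN ext]]] := curv_extension lo_s.
have memV v : (v \in B ++ N) = (v \in vertices P).
  rewrite memBN; apply/hasP/mem_vertices => [[C]|[C CP vC]]; last by exists C; rewrite ?sP.
  by rewrite sP => CP vC; exists C.
(* For each variable, the flat function extending its indicator on [B]. *)
have [w wP] : exists w : 'I_n -> nat * nat -> int, forall j : 'I_n,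
    (forall v, v \in B -> w j v = (v == vtx j)%:R) /\ (forall C, C \in s -> curv (w j) C = 0).
  apply: (fin_all_exists (U := fun _ => nat * nat -> int)
    (P := fun j w => (forall v, v \in B -> w v = (v == vtx j)%:R) /\
      (forall C, C \in s -> curv w C = 0))).
  by move=> j; apply: (ext (fun v => (v == vtx j)%:R) (fun _ => 0)).
pose k := (\sum_(i < n) \sum_(j < n) `|w j (vtx i)|)%N.
have kP (i j : 'I_n) : 0 <= w j (vtx i) + k%:Z.
  have : (`|w j (vtx i)| <= k)%N.
    rewrite /k (bigD1 i) //= (bigD1 j) //= -!addnA; exact: leq_addr.
  lia.
(* The shift by [k] makes exponents nonnegative and keeps the balance, as both monomials of a minor
   have two variables. *)
pose mu (i : 'I_n) := [multinom `|(w j (vtx i) + k%:Z)%R|%N | j < n].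
have muE (i j : 'I_n) : (mu i j)%:Z = w j (vtx i) + k%:Z by rewrite mnmE gez0_abs ?kP.
pose B' := [set i : 'I_n | vtx i \in B].
have cardB' : #|B'| = size B.
  have uB : uniq B by move: uBN; rewrite cat_uniq => /andP[].
  rewrite cardE -(size_map (@vtx P)); apply/perm_size/uniq_perm => // [|v].
    by rewrite (map_inj_uniq (@vtx_inj P)) enum_uniq.
  apply/mapP/idP => [[i + ->]|vB]; first by rewrite mem_enum inE.
  have [i ei] : exists i : 'I_n, vtx i = v by apply/vtx_onto; rewrite -memV mem_cat vB.
  by exists i; rewrite ?mem_enum ?inE ei.
exists (fun f => monomial_map K mu f = 0), B'; split.
- exact: kernel_prime.
- apply: polyomino_ideal_sub => [|a b ab]; first by case: (kernel_prime (monomial_map K mu)).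
  have [i [j [i' [j' [ei ej ei' ej']]]]] := inner_corners ab.
  rewrite (minorE K ei ej ei' ej') rmorphB /= !monomial_map_X; apply/eqP; rewrite subr_eq0.
  rewrite !exponentD !exponent1; suff -> : (mu i + mu j = mu i' + mu j')%MM by [].
  apply/mnmP => t; have [_ flat] := wP t.
  have := @flat_interval (w t) _ _ _ ab; rewrite -ei' -ej' -ei -ej => h.
  have {}h : w t (vtx i) + w t (vtx j) = w t (vtx i') + w t (vtx j').
    by apply: h => C CP; apply: flat; rewrite sP.
  by rewrite !mnmDE; have := muE i t; have := muE j t; have := muE i' t; have := muE j' t; lia.
- apply: monomial_map_inj => m m' sm sm' /mnmP e.
  have expE (m0 : 'X_{1..n}) (s0 : forall i, i \notin B' -> m0 i = 0%N) j : j \in B' ->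
      exponent mu m0 j = (m0 j + k * mdeg m0)%N.
    rewrite inE => jB; rewrite exponentE mdegE big_distrr /=.
    rewrite (bigD1 j) //= [in RHS](bigD1 j) //= addnA; congr (_ + _)%N.
      have := muE j j; rewrite (wP j).1 // eqxx; nia.
    apply: eq_bigr => i ne; have [iB|/s0 ->] := boolP (i \in B'); last by rewrite !muln0.
    have := muE i j; rewrite (wP j).1 ?(inj_eq (@vtx_inj P)) ?(negPf ne); last by rewrite inE in iB.
    by rewrite add0r => -[->].
  (* The sum over [B'] determines the degree, and the degree removes the shift from each
     exponent. *)
  have sumE (m0 : 'X_{1..n}) (s0 : forall i, i \notin B' -> m0 i = 0%N) :
      (\sum_(j in B') exponent mu m0 j)%N = (mdeg m0 * (1 + #|B'| * k))%N.
    rewrite (eq_bigr (fun j => m0 j + k * mdeg m0)%N) => [|j]; last exact: expE.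
    have d : mdeg m0 = (\sum_(j in B') m0 j)%N.
      by rewrite mdegE (bigID (mem B')) /= [X in (_ + X)%N]big1 ?addn0.
    by rewrite big_split sum_nat_const /= -d; nia.
  have degE : mdeg m = mdeg m'.
    apply/eqP; rewrite -(@eqn_pmul2r (1 + #|B'| * k)) // -!sumE //.
    by apply/eqP; apply: eq_bigr => j _; rewrite e.
  apply/mnmP => i; have [iB|iB] := boolP (i \in B'); last by rewrite sm ?sm'.
  by have := e i; rewrite !expE // degE; lia.
- rewrite cardB' -sN -size_cat -cardfE; apply/perm_size/uniq_perm => //.
  exact: fset_uniq.
Qed.

End Konig.

(** * Construction of the regular sequence and computation of the height *)

Section Konig.
Variables (K : fieldType) (P : {fset nat * nat}).
Hypothesis treeP : tree_polyomino P.
Local Notation n := #|{: vertices P}|.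
Local Notation S := (polyomino_ring K P).
Variable s : seq (nat * nat).
Hypotheses (lo_s : leaf_order s) (sP : s =i P).

Lemma strip_inner T : maximal_strip s T -> inner_interval P (strip_ll T) (strip_ur T).
Proof.
case: T => o f l h [/= lh Ss _ _]; rewrite /strip_ll /strip_ur /strip_cell /= in Ss *.
split; first by case: o {Ss}; rewrite /proper_interval /=; lia.
case=> c1 c2; rewrite -sP /le2; case: o Ss => /= Ss; rewrite -?[(_ + _)%R]/(_ + _)%N => le1 le2.
  have -> : c1 = f by lia.
  by apply: Ss; lia.
have -> : c2 = f by lia.
by apply: Ss; lia.
Qed.

(** The variables are given by their indices. The sign in [data_minor] allows the leading pair to be
    anti-diagonal. *)
Record konig_data := KonigData {
  data_interval : 'I_(size s) -> (nat * nat) * (nat * nat);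
  data_lead1 : 'I_(size s) -> 'I_n; data_lead2 : 'I_(size s) -> 'I_n;
  data_trail1 : 'I_(size s) -> 'I_n; data_trail2 : 'I_(size s) -> 'I_n;
  data_weight : 'I_n -> nat;
  data_inner : forall i, inner_interval P (data_interval i).1 (data_interval i).2;
  data_minor : forall i, exists e : bool,
    minor K P (data_interval i) =
      (-1) ^+ e * ('X_[U_(data_lead1 i) + U_(data_lead2 i)] - 'X_[U_(data_trail1 i) + U_(data_trail2 i)]);
  data_lead1_inj : injective data_lead1;
  data_lead2_inj : injective data_lead2;
  data_lead12_neq : forall i j, data_lead1 i != data_lead2 j;
  data_weight_lt : forall i, (data_weight (data_trail1 i) + data_weight (data_trail2 i)
    < data_weight (data_lead1 i) + data_weight (data_lead2 i))%N }.

Lemma konig_data_exists : inhabited konig_data.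
Proof.
have diag x y : (x, y) \in s -> (x.+1, y.+1) \in s -> ((x.+1, y) \in s) || ((x, y.+1) \in s).
  by rewrite !sP; apply: tree_diagonal.
have adiag x y : (x.+1, y) \in s -> (x, y.+1) \in s -> ((x, y) \in s) || ((x.+1, y.+1) \in s).
  by rewrite !sP; apply: tree_antidiagonal.
pose cell (i : 'I_(size s)) := nth (0, 0)%N s i.
have cell_in i : cell i \in s by apply: mem_nth.
have cell_inj i j : cell i = cell j -> i = j.
  by move/eqP; rewrite /cell nth_uniq ?(leaf_order_uniq lo_s) // => /eqP/val_inj.
pose S0 := Strip true 0 0 0.
have /(_ _)/constructive_indefinite_description J0 C : exists T, C \in s -> owns s T C.
  have [Cs|Cs] := boolP (C \in s); last by exists S0.
  by have [T TC] := owner_exists lo_s Cs; exists T.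
pose J C := proj1_sig (J0 C).
have JP C : C \in s -> owns s (J C) C by exact: (proj2_sig (J0 C)).
have Jmax i : maximal_strip s (J (cell i)) by case: (JP _ (cell_in i)).
have Jinj i j : J (cell i) = J (cell j) -> i = j.
  move=> e; apply: cell_inj; apply: (owner_inj (S := J (cell i))); first exact: JP.
  by rewrite e; apply: JP.
have [w wlt] := weights_exist lo_s JP.
have corners i : exists abcd : 'I_n * 'I_n * 'I_n * 'I_n,
   [/\ vtx abcd.1.1.1 = lead1 (J (cell i)), vtx abcd.1.1.2 = lead2 (J (cell i)),
       vtx abcd.1.2 = trail1 (J (cell i)) & vtx abcd.2 = trail2 (J (cell i))].
  have [x [y [z [t [ex ey ez et]]]]] := inner_corners (strip_inner (Jmax i)).
  move: ex ey ez et; rewrite /lead1 /lead2 /trail1 /trail2 /strip_ll /strip_ur.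
  case: (vert _) => /= ex ey ez et; first by exists (z, t, x, y).
  by exists (x, y, z, t).
have [F FP] := fin_all_exists corners.
(* The shift makes the weights natural numbers; it adds 2k to both sides of each inequality. *)
pose k := (\sum_(i < n) `|w (vtx i)|)%N.
have kP (i : 'I_n) : 0 <= w (vtx i) + k%:Z.
  have : (`|w (vtx i)| <= k)%N by rewrite /k (bigD1 i) //=; exact: leq_addr.
  lia.
split; apply: (@KonigData (fun i => (strip_ll (J (cell i)), strip_ur (J (cell i))))
  (fun i => (F i).1.1.1) (fun i => (F i).1.1.2) (fun i => (F i).1.2) (fun i => (F i).2)
  (fun i => `|(w (vtx i) + k%:Z)%R|%N)).
- by move=> i; apply: strip_inner.
- move=> i; exists (vert (J (cell i))); have [e1 e2 e3 e4] := FP i.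
  have [x [y [z [t [ex ey ez et]]]]] := inner_corners (strip_inner (Jmax i)).
  rewrite (minorE K ex ey ez et); move: e1 e2 e3 e4 ex ey ez et.
  rewrite /lead1 /lead2 /trail1 /trail2 /strip_ll /strip_ur.
  case: (vert _) => /= <- <- <- <- /vtx_inj -> /vtx_inj -> /vtx_inj -> /vtx_inj ->.
    by rewrite expr1 mulN1r opprB.
  by rewrite expr0 mul1r.
- move=> i j e; apply: Jinj; have [e1 _ _ _] := FP i; have [e1' _ _ _] := FP j.
  by apply: (lead1_inj (Jmax i) (Jmax j)); rewrite -e1 -e1' e.
- move=> i j e; apply: Jinj; have [_ e2 _ _] := FP i; have [_ e2' _ _] := FP j.
  by apply: (lead2_inj (Jmax i) (Jmax j)); rewrite -e2 -e2' e.
- move=> i j; have [e1 _ _ _] := FP i; have [_ e2' _ _] := FP j.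
  apply/negP => /eqP e; have := lead12_neq diag adiag (Jmax i) (Jmax j).
  by rewrite -e1 -e2' e eqxx.
- move=> i; have [e1 e2 e3 e4] := FP i; have := wlt _ (cell_in i).
  rewrite -e1 -e2 -e3 -e4; have := kP (F i).1.1.1; have := kP (F i).1.1.2.
  by have := kP (F i).1.2; have := kP (F i).2; lia.
Qed.

Variable D : konig_data.

Lemma polyomino_ideal_minor a b : inner_interval P a b -> polyomino_ideal (minor K P (a, b)).
Proof. by move=> ab; apply: ideal_gen_in; exists a, b. Qed.

(** The bound on independent sets gives the chains below every prime over the ideal; the toric prime
    has too many independent variables for a longer chain. *)
Lemma polyomino_height : is_height (@polyomino_ideal K P) (size s).
Proof.
split=> [p pP Ip|].
  apply: prime_chain_ge => // B indB.
  apply: (independent_card pP _ (@data_lead1_inj D) (@data_lead2_inj D)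
    (@data_lead12_neq D) (@data_weight_lt D) indB) => i.
  have [e eD] := data_minor D i; have [[_ _ pM] _ _] := pP.
  rewrite -!mpolyXD.
  have -> : 'X_[U_(data_lead1 D i) + U_(data_lead2 D i)] -
      'X_[U_(data_trail1 D i) + U_(data_trail2 D i)] =
     (-1) ^+ e * minor K P (data_interval D i).
    by rewrite eD mulrA -signr_addb addbb expr0 mul1r.
  apply/pM/Ip; have := data_inner D i; case: (data_interval D i) => a b; exact: polyomino_ideal_minor.
have [p [B [pP Ip indB cardB]]] := toric_prime K lo_s sP.
exists p; split=> // /(prime_chain_le indB).
by rewrite addnS cardB ltnn.
Qed.

Lemma initial_minor i :
  initial_monomial (weight_le (data_weight D)) (minor K P (data_interval D i)) =
  'X_[U_(data_lead1 D i) + U_(data_lead2 D i)].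
Proof.
have [e ->] := data_minor D i; set m1 := (U_(data_lead1 D i) + _)%MM.
set m2 := (U_(data_trail1 D i) + _)%MM.
have lt21 : (weight (data_weight D) m2 < weight (data_weight D) m1)%N.
  by rewrite !weightD !weight1 data_weight_lt.
have ne : m1 != m2 by apply: contraTneq lt21 => ->; rewrite ltnn.
have e1 : (-1) ^+ e * ('X_[m1] - 'X_[m2]) = ((-1) ^+ e : K) *: ('X_[m1] - 'X_[m2]) :> S.
  by rewrite -signr_odd -[in RHS]signr_odd; case: (odd e); rewrite ?mulN1r ?scaleN1r ?mul1r ?scale1r.
apply: initial_monomial_max; first exact: weight_le_order.
  rewrite mcoeff_msupp e1 mcoeffZ mcoeffB !mcoeffX eqxx [m2 == m1]eq_sym (negPf ne) subr0 mulr1.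
  by rewrite signr_eq0.
move=> m; rewrite e1 => /msuppZ_le/msuppB_le; rewrite mem_cat !msuppX !inE.
case/orP => /eqP ->; rewrite /weight_le ?eqxx ?lexx ?orbT //.
by rewrite lt21.
Qed.

Lemma polyomino_konig : konig_type K P.
Proof.
exists (size s); first exact: polyomino_height.
exists (codom (data_interval D)), (inner_minors K P), (weight_le (data_weight D)).
have minor_inj : injective (minor K P \o data_interval D).
  move=> i j /= /(congr1 (initial_monomial (weight_le (data_weight D)))); rewrite !initial_minor.
  move/(congr1 (mcoeff (U_(data_lead1 D i) + U_(data_lead2 D i))%MM)); rewrite !mcoeffX eqxx.
  case: eqP => [/mnm1D_eq[[/data_lead1_inj->]//|[_]]|_ /eqP]; last by rewrite oner_eq0.
  by move=> /eqP; rewrite eq_sym (negPf (data_lead12_neq D i j)).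
have mapE : map (minor K P) (codom (data_interval D)) = codom (minor K P \o data_interval D).
  by rewrite /codom /image_mem -map_comp.
split.
- split=> [|a b /codomP[i e]]; first by rewrite size_codom card_ord.
  by have := data_inner D i; rewrite -e.
- exact: inner_minors_minimal.
- rewrite mapE; split; first by rewrite map_inj_uniq ?enum_uniq.
  move=> _ /codomP[i ->] /=; apply/inner_minorsP; have := data_inner D i.
  by case: (data_interval D i) => a b ab; exists a, b.
- exact: weight_le_order.
- rewrite mapE /codom /image_mem -map_comp.
  rewrite (eq_map (g := fun i => 'X_[U_(data_lead1 D i) + U_(data_lead2 D i)])); last first.
    by move=> i /=; rewrite initial_minor.
  rewrite (map_comp (fun m => 'X_[m]) (fun i => (U_(data_lead1 D i) + U_(data_lead2 D i))%MM)).
  apply: regular_monomials => [i j|m /mapP[i _ ->]]; last by rewrite mnmD_eq0 mnm1_eq0.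
  have nthE (k : 'I_(size s)) : nth 0%MM
      [seq (U_(data_lead1 D i) + U_(data_lead2 D i))%MM | i <- enum 'I_(size s)] k =
      (U_(data_lead1 D k) + U_(data_lead2 D k))%MM.
    by rewrite (nth_map k) ?size_enum_ord // nth_ord_enum.
  rewrite size_map size_enum_ord => lti ltj v.
  pose i' := Ordinal lti; pose j' := Ordinal (ltn_trans ltj lti).
  rewrite (nthE i') (nthE j').
  have nij : i' != j' by rewrite -val_eqE /= gtn_eqF.
  (* A variable of the i-th leading pair is not in the j-th, because no vertex is a leading corner
     twice. *)
  rewrite !mnmDE !mnm1E; have [<-|_] := eqVneq (data_lead1 D i') v.
    right; rewrite (inj_eq (@data_lead1_inj D)) eq_sym (negPf nij).
    by rewrite eq_sym (negPf (data_lead12_neq D _ _)).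
  have [<-|_] := eqVneq (data_lead2 D i') v; last by left.
  by right; rewrite (negPf (data_lead12_neq D _ _)) (inj_eq (@data_lead2_inj D)) eq_sym (negPf nij).
Qed.

End Konig.

Theorem corollary5p5 (K : fieldType) (P : {fset nat * nat}) (hP : tree_polyomino P) :
  konig_type K P /\ is_height (@polyomino_ideal K P) #|` P|%fset.
Proof.
have [s lo_s sP] := tree_leaf_order hP.
have [D] := konig_data_exists K hP lo_s sP.
have -> : #|` P|%fset = size s.
  by apply/perm_size/uniq_perm; [apply: fset_uniq | apply: leaf_order_uniq | move=> C; rewrite sP].
by split; [apply: polyomino_konig D | apply: polyomino_height D].
Qed.
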